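(* For every primitive set $A$ consisting of odd integers, $$\sum_{a\in A}\frac{1}{a\log a}\le\sum_{p\in\mathcal P(A)}\frac{1}{p\log p}+\epsilon_0,$$ where $\mathcal P(A)$ is the set of primes dividing some element of $A$.
   Context: A set $A$ of integers greater than $1$ is primitive if no element of $A$ divides any other. $\gamma$ is Euler's constant. A prime $q$ is a Mertens prime if $e^\gamma\prod_{r<q}(1-1/r)\le1/\log q$ (product over primes $r<q$). The constant $\epsilon_0$ is defined by $\epsilon_0=\sum_{p}\big(\frac{e^\gamma}{p}\prod_{r<p}(1-\frac1r)-\frac{1}{p\log p}\big)$, the sum over odd primes $p$ that are not Mertens primes. *)

(* Defs.v *)
From HB Require Import structures.
From mathcomp Require Import all_boot all_order all_algebra.
From mathcomp Require Import all_classical all_reals all_analysis.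
Set Implicit Arguments.
Unset Strict Implicit.
Unset Printing Implicit Defensive.
Import Order.TTheory GRing.Theory Num.Theory.
Import numFieldNormedType.Exports.

Local Open Scope classical_set_scope.
Local Open Scope ring_scope.

Definition primitive_set (A : set nat) : Prop :=
  (forall a, A a -> (1 < a)%N) /\
  (forall a b, A a -> A b -> a != b -> ~~ (a %| b)%N).

Definition prime_divisors (A : set nat) : set nat :=
  [set p | prime p /\ exists2 a, A a & (p %| a)%N].

(* [series harmonic n] is 1 + 1/2 + ... + 1/n. *)
Definition euler_gamma (R : realType) : R :=
  lim ((fun n : nat => series harmonic n - ln n%:R : R) @ \oo).

Definition mertens_prod (R : realType) (q : nat) : R :=
  \prod_(0 <= r < q | prime r) (1 - r%:R^-1).

Definition mertens_prime (R : realType) (q : nat) : Prop :=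
  prime q /\ expR (euler_gamma R) * mertens_prod R q <= (ln q%:R)^-1.

(* The terms are positive, since p is not a Mertens prime, so the series is the
   supremum of its finite partial sums, taken in the extended reals. *)
Definition epsilon0 (R : realType) : \bar R :=
  (\esum_(p in [set p | prime p /\ odd p /\ ~ mertens_prime R p])
     (expR (euler_gamma R) / p%:R * mertens_prod R p
      - (p%:R * ln p%:R)^-1)%:E)%E.

(* Main.v *)
From Stdlib Require Import NArith.
Require Import Defs.
From HB Require Import structures.
From mathcomp Require Import all_boot all_order all_algebra.
From mathcomp Require Import all_classical all_reals all_analysis.
From mathcomp Require Import ring lra zify.
Set Implicit Arguments.
Unset Strict Implicit.
Unset Printing Implicit Defensive.
Import Order.TTheory GRing.Theory Num.Theory.
Import numFieldNormedType.Exports.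
Local Open Scope ring_scope.

(** Call [b * a] a sifted multiple of [a] when no prime below the largest prime
    factor [P(a)] divides [b]; these multiples have density
    [(1 / a) * prod_(r < P(a)) (1 - 1 / r)].  For a primitive set whose elements
    all have least prime factor [q], the sets of sifted multiples are disjoint
    and contained in that of [q], so the densities add up to at most
    [(1 / q) * prod_(r < q) (1 - 1 / r)].  An odd composite [a] is at least
    [3 P(a)], so [1 / (a log a)] is at most [exp gamma] times its density as soon
    as [1 <= exp gamma * log (3 q) * prod_(r < q) (1 - 1 / r)] for every odd prime
    [q]; grouping the elements of [A] by least prime factor then concludes.

    That explicit form of Mertens' theorem is reduced to a finite computation
    below [144 ^ 2].  If it failed for a larger [q] with a gap [d > 0], then,
    because the sum of [log p / (p - 1)] over [p < q] is at most [log (3 q) - 1],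
    the comparison of [log N!] with its prime factorisation and Abel summation
    would propagate
    [- log prod_(r <= N) (1 - 1 / r) >= gamma + d + log (log (N + 1))] to all
    large [N].  Weighting the primes by [p ^ (- s)] and letting [s] tend to [0],
    this contradicts [zeta (1 + s) <= 1 + 1 / s]. *)

(** * Numerical bounds for the logarithm *)

Section Logarithm.
Variable R : realType.
Implicit Types (x y : R) (n m : nat).

Lemma ln_le_subr1 x : 0 < x -> ln x <= x - 1.
Proof. by move=> x0; have := @le_ln1Dx R (x - 1); rewrite (addrC 1) subrK; apply; lra. Qed.

Lemma ln_ge_1subV x : 0 < x -> 1 - x^-1 <= ln x.
Proof.
move=> x0; have := @ln_le_subr1 x^-1; rewrite invr_gt0 => /(_ x0).
by rewrite lnV ?posrE//; lra.
Qed.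

Lemma ln_nat_ge0 n : 0 <= ln n%:R :> R.
Proof.
case: n => [|n]; first by rewrite ln0.
by rewrite ln_ge0// ler1n.
Qed.

Lemma ln_nat_gt0 n : (1 < n)%N -> 0 < ln n%:R :> R.
Proof. by move=> n1; rewrite ln_gt0// ltr1n. Qed.

Lemma ler_ln_nat m n : (0 < m)%N -> (m <= n)%N -> ln m%:R <= ln n%:R :> R.
Proof.
move=> m0 mn; rewrite ler_ln ?posrE ?ltr0n ?ler_nat//.
exact: leq_trans mn.
Qed.

Lemma lnS_le n : (0 < n)%N -> ln n.+1%:R <= ln n%:R + n%:R^-1 :> R.
Proof.
move=> n0; have n0' : 0 < n%:R :> R by rewrite ltr0n.
have := @ln_le_subr1 (n.+1%:R / n%:R); rewrite divr_gt0 ?ltr0n// => /(_ isT).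
rewrite ln_div ?posrE ?ltr0n//.
have -> : n.+1%:R / n%:R - 1 = n%:R^-1 :> R.
  by rewrite -natr1; field; rewrite gt_eqF.
by rewrite lerBlDl.
Qed.

Lemma lnS_ge n : (0 < n)%N -> ln n%:R + n.+1%:R^-1 <= ln n.+1%:R :> R.
Proof.
move=> n0; have n0' : 0 < n%:R :> R by rewrite ltr0n.
have := @ln_ge_1subV (n.+1%:R / n%:R); rewrite divr_gt0 ?ltr0n// => /(_ isT).
rewrite ln_div ?posrE ?ltr0n// invf_div.
have -> : 1 - n%:R / n.+1%:R = n.+1%:R^-1 :> R.
  by rewrite -natr1; field; rewrite natr1 pnatr_eq0.
by rewrite lerBrDl.
Qed.

Lemma ler_expR_double c d x :
  0 <= c -> c <= expR x -> d <= c * c -> d <= expR (2 * x).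
Proof.
move=> c0 cx /le_trans; apply; rewrite (_ : 2 * x = x + x) ?expRD; last by lra.
by rewrite ler_pM.
Qed.

(* The constants in the next proofs come from squaring [1 + x / 2 ^ k <= expR (x / 2 ^ k)]
   repeatedly, rounding down at each step. *)
Lemma ln2_bounds : 69/100 <= ln 2 :> R /\ ln 2 <= (693 + 4/10)/1000 :> R.
Proof.
split.
  (* Repeated squaring only bounds [expR] from below, so [expR (69/100) <= 2] is obtained from its
     reciprocal. *)
  suff h : 1/2 <= expR (- (69/100)) :> R.
    rewrite -ler_expR lnK ?posrE// -[69/100]opprK expRN invf_ple ?posrE ?expR_gt0//.
    by apply: le_trans h; lra.
  have h0 : (99 + 460/1000 + 9/(10*1000))/100 <= expR (- (69/100)/128) :> R.
    by apply: le_trans (expR_ge1Dx _); lra.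
  rewrite (_ : - (69/100) = 2 * (2 * (2 * (2 * (2 * (2 * (2 * (- (69/100)/128))))))));
    last by lra.
  apply: (@ler_expR_double ((70 + 724/1000)/100)); [lra| |lra].
  apply: (@ler_expR_double ((84 + 98/1000)/100)); [lra| |lra].
  apply: (@ler_expR_double ((91 + 705/1000)/100)); [lra| |lra].
  apply: (@ler_expR_double ((95 + 763/1000)/100)); [lra| |lra].
  apply: (@ler_expR_double ((97 + 859/1000)/100)); [lra| |lra].
  apply: (@ler_expR_double ((98 + 924/1000)/100)); [lra| |lra].
  apply: (@ler_expR_double ((99 + 460/1000 + 9/(10*1000))/100)); [lra| |lra].
  exact: h0.
rewrite -ler_expR lnK ?posrE//.
rewrite (_ : (693 + 4/10)/1000 =
  2 * (2 * (2 * (2 * (2 * (2 * (2 * (2 * (2 * (2 * ((693 + 4/10)/1000/1024))))))))))); last by lra.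
apply: (@ler_expR_double (1 + (414 + (225 + 763/1000)/1000)/1000)); [lra| |lra].
apply: (@ler_expR_double (1 + (189 + (212 + 245/1000)/1000)/1000)); [lra| |lra].
apply: (@ler_expR_double (1 + (90 + (510 + 85/1000)/1000)/1000)); [lra| |lra].
apply: (@ler_expR_double (1 + (44 + (274 + 909/1000)/1000)/1000)); [lra| |lra].
apply: (@ler_expR_double (1 + (21 + (897 + 700/1000)/1000)/1000)); [lra| |lra].
apply: (@ler_expR_double (1 + (10 + (889 + 559/1000)/1000)/1000)); [lra| |lra].
apply: (@ler_expR_double (1 + (5 + (430 + 37/1000)/1000)/1000)); [lra| |lra].
apply: (@ler_expR_double (1 + (2 + (711 + 343/1000)/1000)/1000)); [lra| |lra].
apply: (@ler_expR_double (1 + (1 + (354 + 754/1000)/1000)/1000)); [lra| |lra].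
apply: (@ler_expR_double (1 + (0 + (677 + 148/1000)/1000)/1000)); [lra| |lra].
by apply: le_trans (expR_ge1Dx _); lra.
Qed.

Lemma expR_056_ge : 174/100 <= expR (56/100) :> R.
Proof.
rewrite (_ : 56/100 = 2 * (2 * (2 * (2 * (2 * (2 * (2 * (2 * (56/100/256))))))))); last by lra.
apply: (@ler_expR_double (1 + (322 + (725 + 204/1000)/1000)/1000)); [lra| |lra].
apply: (@ler_expR_double (1 + (150 + (97 + 911/1000)/1000)/1000)); [lra| |lra].
apply: (@ler_expR_double (1 + (72 + (426 + 180/1000)/1000)/1000)); [lra| |lra].
apply: (@ler_expR_double (1 + (35 + (580 + 118/1000)/1000)/1000)); [lra| |lra].
apply: (@ler_expR_double (1 + (17 + (634 + 570/1000)/1000)/1000)); [lra| |lra].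
apply: (@ler_expR_double (1 + (8 + (778 + 752/1000)/1000)/1000)); [lra| |lra].
apply: (@ler_expR_double (1 + (4 + (379 + 785/1000)/1000)/1000)); [lra| |lra].
apply: (@ler_expR_double (1 + (2 + (187 + 500/1000)/1000)/1000)); [lra| |lra].
by apply: le_trans (expR_ge1Dx _); lra.
Qed.

End Logarithm.

(** * Elementary Stirling bounds and a telescoping tail estimate *)

Section Factorial.
Variable R : realType.
Implicit Types (n m k : nat).

Lemma ln_fact_ge n : n%:R * (ln n.+1%:R - 1) <= ln n`!%:R :> R.
Proof.
elim: n => [|n IH]; first by rewrite mul0r ln1.
rewrite factS natrM lnM ?posrE ?ltr0n ?fact_gt0//.
have n0 : 0 < n.+1%:R :> R by rewrite ltr0n.
have h : n.+1%:R * ln n.+2%:R <= n.+1%:R * ln n.+1%:R + 1 :> R.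
  by have := @lnS_le R n.+1 isT; rewrite -(ler_pM2l n0) mulrDr divff ?gt_eqF.
move: h IH; rewrite mulrBr mulr1 mulrBr mulr1.
move: (ln n.+2%:R) (ln n.+1%:R) (ln n`!%:R) => a b c.
by rewrite -natr1 mulrDl mul1r; nra.
Qed.

Lemma ln_fact_le n : (0 < n)%N ->
  ln n`!%:R <= n%:R * ln n%:R - n%:R + 1 + ln n%:R :> R.
Proof.
elim: n => // -[|n] IH _; first by rewrite ln1; lra.
have {}IH := IH isT.
rewrite factS natrM lnM ?posrE ?ltr0n ?fact_gt0//.
have n0 : 0 < n.+2%:R :> R by rewrite ltr0n.
have h : n.+2%:R * ln n.+1%:R + 1 <= n.+2%:R * ln n.+2%:R :> R.
  by have := @lnS_ge R n.+1 isT; rewrite -(ler_pM2l n0) mulrDr divff ?gt_eqF.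
move: h IH; move: (ln n.+2%:R) (ln n.+1%:R) (ln (n.+1)`!%:R) => a b c.
by rewrite -[n.+2%:R]natr1 !mulrDl !mul1r; nra.
Qed.

Lemma sum_ln_div_le y N : (0 < y)%N ->
  \sum_(y <= k < N) ln k.+1%:R / (k.+1%:R * k%:R) <= (ln y%:R + 2) / y%:R :> R.
Proof.
move=> y0.
(* The decrease [h k - h k.+1] dominates the summand, so the sum telescopes. The constant [2] pays
   for [(k + 1) * (ln k.+1 - ln k) <= 2]. *)
pose h k : R := (ln k%:R + 2) / k%:R.
have [Ny|yN] := leqP N y.
  by rewrite big_geq// divr_ge0// addr_ge0// ln_nat_ge0.
apply: (@le_trans _ _ (h y - h N)); last first.
  by rewrite lerBlDr lerDl divr_ge0// addr_ge0// ln_nat_ge0.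
rewrite -opprB -telescope_sumr; last exact: ltnW.
rewrite -sumrN; apply: ler_sum_nat => k /andP[yk _].
have k0 : (0 < k)%N by exact: leq_trans yk.
have k1 : 1 <= k%:R :> R by rewrite ler1n.
have ab := @lnS_le R k k0.
have ba : ln k%:R <= ln k.+1%:R :> R by exact: ler_ln_nat.
rewrite /h; move: ab ba; set b := ln k.+1%:R; set a := ln k%:R => ab ba.
rewrite -[k.+1%:R]natr1; move: k%:R k1 ab => {yk k0} x x1 ab.
have ax : (b - a) * x <= 1 by rewrite -ler_pdivlMr ?div1r ?lerBlDl//; lra.
have -> : - ((b + 2) / (x + 1) - (a + 2) / x) =
   b / ((x + 1) * x) + ((x + 1) * (a - b) + 2) / ((x + 1) * x).
  by field; rewrite !gt_eqF//; lra.
have ab1 : b - a <= 1 by nra.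
by rewrite lerDl divr_ge0//; nra.
Qed.

End Factorial.

(** * Harmonic sums and a numerical lower bound for Euler's constant *)

Section EulerConstant.
Variable R : realType.
Implicit Types (n m k : nat).

Let H n : R := series harmonic n.

Lemma harmonicS n : H n.+1 = H n + n.+1%:R^-1.
Proof. by rewrite /H seriesSr. Qed.

(** The index is shifted by one because monotonicity fails at [0]: with [ln 0 = 0] the unshifted
    sequence starts with [0], then [1]. *)
Let u n : R := H n.+1 - ln n.+1%:R.

Let u_nincr : nonincreasing_seq u.
Proof.
apply/nonincreasing_seqP => n; rewrite /u (harmonicS n.+1).
have := @lnS_ge R n.+1 isT.
by move: (ln n.+1%:R) (ln n.+2%:R) (n.+2%:R^-1) (H n.+1) => a b c d; lra.
Qed.

Let w_ndecr : {homo (fun n => H n - ln n.+1%:R) : m n / (m <= n)%N >-> m <= n}.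
Proof.
apply/nondecreasing_seqP => n; rewrite harmonicS.
have := @lnS_le R n.+1 isT.
by move: (ln n.+1%:R) (ln n.+2%:R) (n.+1%:R^-1) (H n) => a b c d; lra.
Qed.

Lemma ln_le_harmonic n : ln n.+1%:R <= H n.
Proof. by have := w_ndecr (leq0n n); rewrite /H /series/= big_geq// ln1; lra. Qed.

Let u_cvg : cvgn u.
Proof.
apply: nonincreasing_is_cvgn u_nincr _; exists 0 => _ [n _ <-].
have := ln_le_harmonic n; rewrite /u harmonicS => h.
have : ln n.+1%:R <= ln n.+2%:R :> R by exact: ler_ln_nat.
have : 0 <= n.+1%:R^-1 :> R by rewrite invr_ge0.
by move: h; move: (ln n.+1%:R) (n.+1%:R^-1) (H n) => a b c; lra.
Qed.

Let u_cvg_gamma : (u @ \oo --> euler_gamma R)%classic.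
Proof.
have /cvg_ex[l ul] := u_cvg.
have vl : ((fun n => series harmonic n - ln n%:R : R) @ \oo --> l)%classic.
  by rewrite -cvg_shiftS.
by rewrite /euler_gamma (cvg_lim _ vl).
Qed.

(** The left side is nondecreasing in [n] and stays below [u], which converges to gamma. *)
Lemma euler_gamma_ge n : H n - ln n.+1%:R <= euler_gamma R.
Proof.
rewrite -(cvg_lim _ u_cvg_gamma)//.
apply: limr_ge => //; exists n => // m /= nm.
apply: le_trans (w_ndecr nm) _.
by rewrite /u harmonicS lerD2r lerDl invr_ge0.
Qed.

Lemma harmonic_le d : 0 < d -> exists K, forall k, (K <= k)%N ->
  H k <= euler_gamma R + d + ln k%:R.
Proof.
move=> d0; have /cvgrPdist_lt/(_ _ d0)[K _ hK] := u_cvg_gamma.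
exists K.+1 => -[//|k]; rewrite ltnS => Kk.
have /ltW := hK k Kk; rewrite ler_norml => /andP[+ _]; rewrite /u.
by move: (ln k.+1%:R) (H k.+1) (euler_gamma R) => a b c; lra.
Qed.

(** This turns [exp gamma * log x] into the rational multiple [12/10] of a binary logarithm, which
    the finite computation can handle. *)
Lemma expR_gamma_ln2 : 12/10 <= expR (euler_gamma R) * ln 2.
Proof.
have [l1 l2] := @ln2_bounds R.
have g : 56/100 <= euler_gamma R.
  (* The index [31] is chosen since [ln 32 = 5 * ln 2]. The harmonic sum is then bounded in four
     short blocks. *)
  apply: le_trans (euler_gamma_ge 31).
  have -> : (32 : R) = 2 ^+ 5 by rewrite -natrX.
  rewrite lnXn// -mulr_natr /H /series /=.
  have h1 : (271 + 78/100)/100 <= \sum_(0 <= i < 8) harmonic i :> R.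
    by rewrite !big_nat_recl// big_geq// /=; lra.
  have h2 : (66 + 28/100)/100 <= \sum_(8 <= i < 16) harmonic i :> R.
    by rewrite (big_addn 0 16 8) !big_nat_recl// big_geq// /= !(addSn, add0n); lra.
  have h3 : (39 + 52/100)/100 <= \sum_(16 <= i < 24) harmonic i :> R.
    by rewrite (big_addn 0 24 16) !big_nat_recl// big_geq// /= !(addSn, add0n); lra.
  have h4 : (25 + 12/100)/100 <= \sum_(24 <= i < 31) harmonic i :> R.
    by rewrite (big_addn 0 31 24) !big_nat_recl// big_geq// /= !(addSn, add0n); lra.
  rewrite (big_cat_nat _ (n := 8))//= (big_cat_nat _ (n := 16) (m := 8))//=.
  rewrite (big_cat_nat _ (n := 24) (m := 16))//=.
  move: h1 h2 h3 h4 l2; do 4!move: (bigop _ _ _).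
  by move: (ln _) => a b c d e; lra.
have e : 174/100 <= expR (euler_gamma R).
  by apply: le_trans (@expR_056_ge R) _; rewrite ler_expR.
have h0 : 0 <= 174/100 :> R by lra.
have h1 : 0 <= 69/100 :> R by lra.
by have := ler_pM h0 h1 e l1; lra.
Qed.

End EulerConstant.

(** * Legendre's formula and Chebyshev's bound *)

Section LegendreFormula.
Local Open Scope nat_scope.
Implicit Types (n p : nat).

Lemma logn_factE p n : prime p -> logn p n`! = n %/ p + logn p (n %/ p)`!.
Proof.
move=> pp; have p1 := prime_gt1 pp.
case: n => [|n]; first by rewrite div0n.
have lt : n.+1 %/ p < n.+1 by rewrite ltn_Pdiv.
rewrite !logn_fact// big_ltn// expn1; congr (_ + _).
rewrite big_add1 /= (big_cat_nat _ (n := (n.+1 %/ p).+1))//=.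
rewrite [X in _ + X]big1_seq ?addn0.
  by apply: eq_bigr => k _; rewrite expnS divnMA.
move=> k /andP[_]; rewrite mem_index_iota => /andP[mk _].
rewrite expnS divnMA divn_small//; apply: leq_trans mk _.
by rewrite ltnW// ltn_expl.
Qed.

Lemma logn_fact_le p n : prime p -> p.-1 * logn p n`! <= n.
Proof.
move=> pp; have p1 := prime_gt1 pp.
elim/ltn_ind: n => -[|n] IH; first by rewrite logn1 muln0.
rewrite logn_factE// mulnDr.
have /IH h : n.+1 %/ p < n.+1 by rewrite ltn_Pdiv.
have := leq_trunc_div n.+1 p; move: h; case: p pp p1 {IH} => // p _ _ /=.
by move: (_ %/ _) (logn _ _) => a b; nia.
Qed.

(** By Legendre, [n] minus [p.-1 * logn p n!] is the digit sum of [n] in base [p]; there are at most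
    [J.+1] digits, each at most [p.-1]. *)
Lemma logn_fact_ge p n J : prime p -> n < p ^ J.+1 ->
  n <= p.-1 * (logn p n`! + J.+1).
Proof.
move=> pp; have p1 := prime_gt1 pp.
elim: J n => [|J IH] n nJ.
  by rewrite expn1 in nJ; case: p pp p1 nJ => // p _ _ /=; nia.
have {}/IH h : n %/ p < p ^ J.+1.
  by rewrite ltn_divLR ?prime_gt0// mulnC -expnS.
rewrite logn_factE//.
have := divn_eq n p; have := ltn_pmod n (ltnW p1).
move: h; case: p pp p1 {nJ} => // p _ _ /=.
move: (_ %/ _) (_ %% _) (logn _ _) => a b c h1 h2 ->; nia.
Qed.

Lemma logn_fact_eq0 p n : prime p -> n < p -> logn p n`! = 0.
Proof. by move=> pp np; rewrite logn_factE// divn_small// logn1. Qed.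

Lemma logn_fact_small p n : prime p -> n < p ^ 2 -> logn p n`! = n %/ p.
Proof.
move=> pp np; rewrite logn_factE// (@logn_fact_eq0 p (n %/ p)) ?addn0//.
by rewrite ltn_divLR ?prime_gt0// mulnn.
Qed.

End LegendreFormula.

Section LnFact.
Variable R : realType.

Lemma ln_prod (I : Type) (r : seq I) (P : pred I) (F : I -> R) :
  (forall i, P i -> 0 < F i) ->
  ln (\prod_(i <- r | P i) F i) = \sum_(i <- r | P i) ln (F i).
Proof.
move=> F0; elim: r => [|a r IH]; first by rewrite !big_nil ln1.
rewrite !big_cons; case: ifP => // Pa.
by rewrite lnM ?posrE ?F0 ?prodr_gt0// IH.
Qed.

Lemma ln_fact n : ln n`!%:R = \sum_(0 <= p < n.+1 | prime p) (logn p n`!)%:R * ln p%:R :> R.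
Proof.
have f0 := fact_gt0 n.
have [N nN fN] : exists2 N, (n <= N)%N & (n`! <= N)%N.
  by exists (maxn n n`!); rewrite ?leq_maxl ?leq_maxr.
rewrite -{1}(partnT f0) (widen_partn _ fN) natr_prod.
rewrite (bigID prime)/= [X in _ * X]big1 ?mulr1; last first.
  by move=> p /= np; rewrite lognE (negbTE np).
rewrite ln_prod; last first.
  by move=> p pp; rewrite natrX exprn_gt0// ltr0n prime_gt0.
rewrite (big_cat_nat _ (n := n.+1))//= [X in _ + X]big1_seq ?addr0.
  apply: eq_bigr => p pp; rewrite natrX lnXn ?ltr0n ?prime_gt0//.
  by rewrite mulr_natl.
move=> p /andP[pp]; rewrite mem_index_iota => /andP[np _].
by rewrite logn_fact_eq0// expn0 ln1.
Qed.
End LnFact.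

(** * Chebyshev's bound for the primorial, and a crude count of primes *)

Section Chebyshev.
Local Open Scope nat_scope.
Implicit Types (n m p : nat).

Lemma prod_primes_dvd (s : seq nat) N :
  uniq s -> all prime s -> all (dvdn^~ N) s -> \prod_(p <- s) p %| N.
Proof.
elim: s => [|p s IH]; first by rewrite big_nil dvd1n.
rewrite big_cons /= => /andP[ps us] /andP[pp sp] /andP[pN sN].
rewrite Gauss_dvd ?pN ?IH// {IH sN us}; elim: s ps sp => [|q s IH].
  by rewrite big_nil coprimen1.
rewrite big_cons inE negb_or /= => /andP[pq ps] /andP[pq' sp].
by rewrite coprimeMr IH// prime_coprime// dvdn_prime2// pq.
Qed.

(** The two middle coefficients are equal and both occur in the expansion of
    [(1 + 1) ^ (2 * m + 1)]. *)
Lemma bin_odd_le m : 'C(m.*2.+1, m) <= 4 ^ m.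
Proof.
rewrite -(leq_pmul2l (ltn0Sn 1)).
have -> : 2 * 4 ^ m = 2 ^ m.*2.+1 by rewrite expnS -mul2n expnM.
rewrite -[2 ^ _]/((1 + 1) ^ _) Pascal.
have mlt : m < m.*2.+2 by rewrite -addnn; lia.
have mlt1 : m.+1 < m.*2.+2 by rewrite -addnn; lia.
rewrite (bigD1 (Ordinal mlt))//= (bigD1 (Ordinal mlt1))/=; last first.
  by rewrite -val_eqE /= gtn_eqF.
rewrite !exp1n !muln1 mul2n -addnn addnA.
rewrite [X in _ <= _ + X + _](_ : _ = 'C(m.*2.+1, m)) ?leq_addr//.
by rewrite -bin_sub -?addnn; [congr 'C(_, _)|]; lia.
Qed.

(** Erdős's induction: an even [n > 2] adds no prime, and for [n = 2 * m + 1] the primes from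
    [m + 2] to [n] all divide ['C(n, m)]. *)
Lemma primorial_le n : \prod_(0 <= p < n.+1 | prime p) p <= 4 ^ n.
Proof.
elim/ltn_ind: n => n IH.
have [n2|n3] := leqP n 2.
  by case: n n2 {IH} => [|[|[|]]]// _; rewrite unlock.
have [on|en] := boolP (odd n); last first.
  rewrite big_mkcond big_nat_recr//= -big_mkcond ifN ?muln1; last first.
    by apply: contra en => /even_prime [nE|//]; move: n3; rewrite nE.
  case: n n3 IH {en} => // n _ IH.
  by apply: leq_trans (IH n _) _ => //; rewrite leq_exp2l.
pose m := n./2; have nE : n = m.*2.+1 by rewrite -[LHS]odd_double_half on.
have m1 : 0 < m by lia.
have mn : m.+1 < n by rewrite nE -addnn; lia.
rewrite (big_cat_nat _ (n := m.+2))//=; last by lia.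
apply: (@leq_trans (4 ^ m.+1 * 4 ^ m)); last first.
  by rewrite -expnD leq_exp2l// nE -addnn; lia.
apply: leq_mul; first exact: IH.
apply: leq_trans (bin_odd_le m); rewrite -nE.
apply: dvdn_leq; first by rewrite bin_gt0; lia.
rewrite -big_filter; apply: prod_primes_dvd.
- by rewrite filter_uniq// iota_uniq.
- by rewrite filter_all.
apply/allP => p; rewrite mem_filter mem_index_iota => /and3P[pp mp pn].
have h := @bin_fact n m ltac:(lia).
have : p %| n`! by rewrite dvdn_fact// prime_gt0//=.
rewrite -h Euclid_dvdM// => /orP[//|]; rewrite Euclid_dvdM// => /orP[] d.
  have := dvdn_leq_log p (fact_gt0 m) d; rewrite logn_prime// eqxx.
  by rewrite logn_fact_eq0//; lia.
have := dvdn_leq_log p (fact_gt0 (n - m)) d; rewrite logn_prime// eqxx.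
by rewrite logn_fact_eq0// nE -addnn; lia.
Qed.

(** Two consecutive integers above [8] include at most one prime, so an induction by steps of two
    works from [y = 8] and [y = 9], where equality holds. *)
Lemma count_primes_le y : 8 <= y -> \sum_(0 <= p < y.+1 | prime p) 1 <= y./2.
Proof.
move=> y8; have [k yE] : exists k, y = 8 + k by exists (y - 8); lia.
rewrite yE {yE y8}; elim/ltn_ind: k => -[|[|k]] IH; [by rewrite unlock|by rewrite unlock|].
rewrite !addnS big_mkcond big_nat_recr// big_nat_recr//= -big_mkcond/=.
have := IH k (leqnSn _).
have : ~~ (prime (8 + k).+1 && prime (8 + k).+2).
  apply/negP => /andP[/even_prime h1 /even_prime h2].
  by case: h1 => [//|/= o1]; case: h2 => [//|/=]; rewrite o1.
by case: prime; case: prime => //= _; lia.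
Qed.

End Chebyshev.

Lemma sum_ln_primes_le (R : realType) n :
  \sum_(0 <= p < n.+1 | prime p) ln p%:R <= n%:R * (2 * ln 2) :> R.
Proof.
rewrite -ln_prod; last by move=> p /prime_gt0; rewrite ltr0n.
rewrite -natr_prod mulrA -natrM mulr_natl -lnXn// -natrX muln2 -mul2n expnM.
by apply: ler_ln_nat (primorial_le n); rewrite prodn_cond_gt0// => p /prime_gt0.
Qed.

(** * An upper bound for the sum of log p / (p - 1) *)

(* The fractional part of [n / p] is dominated by a step function of [p] with
   [k] equal steps between [n / 2] and [n], whose sum against [ln p] is an
   average of Chebyshev functions. *)
Lemma modn_le_count p n k : (0 < p <= n)%N ->
  (k * (n %% p) <= p * \sum_(0 <= i < k) (p * (k + i) <= k * n))%N.
Proof.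
move=> /andP[p0 pn]; have [->|k0] := posnP k; first by rewrite mul0n.
pose m := ((k * (n %% p)) %/ p)%N.
have mk : (m < k)%N by rewrite ltn_divLR// ltn_pmul2l// ltn_pmod.
(* As [n / p] has integer part at least [1], a fractional part at least [i / k] forces
   [n / p >= 1 + i / k]. *)
have h i : (i <= m)%N -> (p * (k + i) <= k * n)%N.
  move=> im; have : (p * i <= k * (n %% p))%N.
    by rewrite mulnC; apply: leq_trans (leq_trunc_div _ p); rewrite leq_mul2r im orbT.
  have : (1 <= n %/ p)%N by rewrite divn_gt0.
  rewrite {3}(divn_eq n p); move: (n %/ p)%N (n %% p)%N => a b; nia.
apply: (@leq_trans (p * m.+1)).
  by rewrite [leqRHS]mulnC; apply/ltnW; exact: ltn_ceil.
rewrite leq_mul2l; apply/orP; right.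
rewrite (big_cat_nat _ (n := m.+1))//=.
apply: leq_trans (leq_addr _ _).
rewrite -[X in (X <= _)%N]subn0 -[X in (X <= _)%N]muln1 -sum_nat_const_nat.
rewrite big_nat_cond [X in (_ <= X)%N]big_nat_cond.
by apply: leq_sum => i; rewrite andbT => /andP[_ im]; rewrite h.
Qed.

Section MertensUpperBound.
Variable R : realType.
Implicit Types (n p k y : nat).

(** After exchanging the sums, step [i] contributes Chebyshev's function at [k * n / (k + i)], to
    which the primorial bound applies. *)
Lemma sum_ln_modn_le y n k : (0 < k)%N ->
  \sum_(y.+1 <= p < n.+1 | prime p) ln p%:R * ((n %% p)%:R / p%:R) <=
  n%:R * (2 * ln 2) * \sum_(0 <= i < k) (k + i)%:R^-1 :> R.
Proof.
move=> k0; have k0' : 0 < k%:R :> R by rewrite ltr0n.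
apply: (@le_trans _ _ (\sum_(y.+1 <= p < n.+1 | prime p)
    k%:R^-1 * \sum_(0 <= i < k) (p * (k + i) <= k * n)%:R * ln p%:R)).
  rewrite big_nat_cond [leRHS]big_nat_cond; apply: ler_sum => p /andP[/andP[_ pn] pp].
  have p0 := prime_gt0 pp; have p0' : 0 < p%:R :> R by rewrite ltr0n.
  rewrite -mulr_suml -natr_sum [leRHS]mulrA [leRHS]mulrC ler_wpM2l ?ln_nat_ge0//.
  rewrite ler_pdivrMr// -mulrA ler_pdivlMl// -!natrM ler_nat.
  by rewrite [leqRHS]mulnC modn_le_count// p0.
rewrite -mulr_sumr exchange_big /= mulr_sumr mulr_sumr.
apply: ler_sum_nat => i /andP[_ ik].
rewrite ler_pdivrMl//.
have ki0 : (0 < k + i)%N by rewrite addn_gt0 k0.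
apply: (@le_trans _ _ (\sum_(0 <= p < ((k * n) %/ (k + i)).+1 | prime p) ln p%:R)).
  rewrite big_mkcond [leRHS]big_mkcond /=.
  pose m := ((k * n) %/ (k + i))%N.
  have mn : (m <= n)%N.
    by rewrite -[leqRHS](mulKn n k0) leq_div2l// leq_addr.
  apply: (@le_trans _ _ (\sum_(0 <= p < n.+1) if prime p && (p <= m)%N then ln p%:R else 0)).
    have [yn|yn] := leqP y.+1 n.+1; last first.
      by rewrite big_geq ?(ltnW yn)// sumr_ge0// => p _; case: ifP; rewrite ?ln_nat_ge0.
    rewrite [leRHS](big_cat_nat _ (n := y.+1))//=.
    rewrite ler_wpDl//; first by rewrite sumr_ge0// => p _; case: ifP; rewrite ?ln_nat_ge0.
    apply: ler_sum_nat => p _; case: ifP => //= _.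
    by rewrite /m leq_divRL//; case: ifP; rewrite ?mul1r ?mul0r.
  rewrite (big_cat_nat _ (n := m.+1))//= [X in _ + X]big1_seq ?addr0; last first.
    move=> p /andP[_]; rewrite mem_index_iota => /andP[mp _].
    by rewrite leqNgt mp andbF.
  by apply: ler_sum_nat => p /andP[_ pm]; rewrite -ltnS pm andbT.
apply: le_trans (sum_ln_primes_le _ _) _.
rewrite [leRHS](_ : _ = k%:R * n%:R / (k + i)%:R * (2 * ln 2)); last by ring.
rewrite ler_wpM2r//.
  by rewrite mulr_ge0// (@ln_nat_ge0 R 2).
by rewrite ler_pdivlMr ?ltr0n// -!natrM ler_nat leq_trunc_div.
Qed.

(** The primes are split at [y], the integer square root of [n]. A prime [p <= y] loses at most
    [(J + 1) * ln p <= 3/2 * ln n] in Legendre's formula, and there are at most [y / 2] of them. For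
    [p > y] the exponent in [n!] is the integer part of [n / p], so the loss is the fractional part
    plus [n / (p * (p - 1))]. *)
Lemma sum_ln_pred_le y n k : (8 <= y)%N -> (y ^ 2 <= n < y.+1 ^ 2)%N -> (0 < k)%N ->
  n%:R * \sum_(0 <= p < n.+1 | prime p) ln p%:R / p.-1%:R <=
  ln n`!%:R + y%:R * (3/4 * ln n%:R)
  + n%:R * \sum_(y.+1 <= p < n.+1 | prime p) ln p%:R / (p%:R * p.-1%:R)
  + n%:R * (2 * ln 2) * \sum_(0 <= i < k) (k + i)%:R^-1 :> R.
Proof.
move=> y8 /andP[yn ny] k0.
have yn1 : (y <= n)%N by apply: leq_trans yn; rewrite -mulnn leq_pmull//; lia.
have n0 : (0 < n)%N by apply: leq_trans yn1; lia.
apply: le_trans (lerD (lexx _) (@sum_ln_modn_le y n k k0)).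
rewrite ln_fact !mulr_sumr.
rewrite (big_cat_nat _ (n := y.+1))//= [X in _ <= X + _ + _ + _](big_cat_nat _ (n := y.+1))//=.
have small : \sum_(0 <= p < y.+1 | prime p) (n%:R * (ln p%:R / p.-1%:R)) <=
    \sum_(0 <= p < y.+1 | prime p) ((logn p n`!)%:R * ln p%:R) + y%:R * (3/4 * ln n%:R) :> R.
  apply: (@le_trans _ _ (\sum_(0 <= p < y.+1 | prime p) ((logn p n`!)%:R * ln p%:R)
     + \sum_(0 <= p < y.+1 | prime p) 1%:R * (3/2 * ln n%:R))).
    rewrite -big_split /= big_nat_cond [leRHS]big_nat_cond.
    apply: ler_sum => p /andP[/andP[_ py] pp].
    have p0 := prime_gt0 pp; have p1 := prime_gt1 pp.
    have pN0 : 0 < p.-1%:R :> R by rewrite ltr0n; lia.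
    pose J := trunc_log p n.
    have [pJ Jp] : (p ^ J <= n)%N /\ (n < p ^ J.+1)%N.
      by split; [exact: trunc_logP|exact: trunc_log_ltn].
    have l1 : J%:R * ln p%:R <= ln n%:R :> R.
      rewrite mulr_natl -lnXn ?ltr0n// -natrX; apply: ler_ln_nat => //.
      by rewrite expn_gt0 p0.
    have l2 : 2 * ln p%:R <= ln n%:R :> R.
      rewrite mulr_natl -lnXn ?ltr0n// -natrX; apply: ler_ln_nat => //.
        by rewrite expn_gt0 p0.
      by apply: leq_trans yn; rewrite leq_exp2r.
    rewrite mul1r mulrA ler_pdivrMr// [leRHS]mulrC.
    apply: (@le_trans _ _ (p.-1%:R * (((logn p n`!) + J.+1)%:R * ln p%:R))).
      rewrite mulrA ler_wpM2r ?ln_nat_ge0// -natrM ler_nat.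
      exact: logn_fact_ge.
    apply: ler_wpM2l; first exact: ltW.
    rewrite natrD mulrDl lerD2l -natr1 mulrDl mul1r.
    by move: l1 l2; move: (J%:R * ln p%:R : R) (ln p%:R : R) (ln n%:R : R) => a b c; lra.
  rewrite lerD2l -mulr_suml -natr_sum.
  have h : (\sum_(0 <= p < y.+1 | prime p) 1)%:R <= y%:R / 2 :> R.
    rewrite ler_pdivlMr// -natrM ler_nat.
    by have := count_primes_le y8; move: (bigop _ _ _) => s; lia.
  apply: (@le_trans _ _ (y%:R / 2 * (3/2 * ln n%:R))).
    by rewrite ler_wpM2r// mulr_ge0// ln_nat_ge0.
  by move: (ln n%:R : R) (y%:R : R) => a b; lra.
have large : \sum_(y.+1 <= p < n.+1 | prime p) (n%:R * (ln p%:R / p.-1%:R)) <=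
   \sum_(y.+1 <= p < n.+1 | prime p) ((logn p n`!)%:R * ln p%:R)
   + \sum_(y.+1 <= p < n.+1 | prime p) (n%:R * (ln p%:R / (p%:R * p.-1%:R)))
   + \sum_(y.+1 <= p < n.+1 | prime p) (ln p%:R * ((n %% p)%:R / p%:R)) :> R.
  rewrite -!big_split /= big_nat_cond [leRHS]big_nat_cond.
  apply: ler_sum => p /andP[/andP[yp _] pp].
  have p0 : p%:R != 0 :> R by rewrite pnatr_eq0 -lt0n prime_gt0.
  have p1 : p.-1%:R != 0 :> R by rewrite pnatr_eq0 -lt0n; have := prime_gt1 pp; lia.
  rewrite logn_fact_small//; last by apply: leq_trans ny _; rewrite leq_exp2r.
  have pE : p%:R = p.-1%:R + 1 :> R by rewrite natr1 prednK// prime_gt0.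
  have nE : n%:R = (n %/ p)%:R * p%:R + (n %% p)%:R :> R.
    by rewrite -natrM -natrD -divn_eq.
  rewrite {1 2}nE le_eqVlt; apply/orP; left; apply/eqP.
  move: (ln p%:R) (n %/ p)%:R (n %% p)%:R => l a b.
  by rewrite pE in p0 *; field; rewrite p0 p1.
move: small large; do 6!move: (bigop _ _ _).
by move: (y%:R * (3/4 * ln n%:R) : R) => *; lra.
Qed.

End MertensUpperBound.

(** * Explicit constants for the range from [144 ^ 2] on *)

Section PrimeReciprocals.
Variable R : realType.
Implicit Types (n p k y N : nat).

Lemma ln3_ge : 19/12 * ln 2 <= ln 3 :> R.
Proof.
have h : ln (2 ^+ 19) <= ln (3 ^+ 12) :> R.
  rewrite ler_ln ?posrE ?exprn_gt0//.
  have -> : 2 ^+ 19 = 2 * 512 * 512 :> R by ring.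
  have -> : 3 ^+ 12 = 729 * 729 :> R by ring.
  by lra.
by move: h; rewrite !lnXn//; lra.
Qed.

Lemma ln144_le : ln 144 <= (499 + 25/100)/100 :> R.
Proof.
have [_ l2] := @ln2_bounds R.
have h : ln (3 ^+ 5) <= ln (2 ^+ 8) :> R.
  by rewrite ler_ln ?posrE ?exprn_gt0// -!natrX ler_nat.
have -> : 144 = 2 ^+ 4 * 3 ^+ 2 :> R by ring.
rewrite lnM ?posrE ?exprn_gt0//; move: h; rewrite !lnXn//.
by lra.
Qed.

Lemma harmonic16_le : \sum_(0 <= i < 16) (16 + i)%:R^-1 <= 709/1000 + 1/(10*1000) :> R.
Proof.
rewrite (big_cat_nat _ (n := 8))//= (big_addn 0 16 8) !big_nat_recl// !big_geq//=.
rewrite !(addSn,addnS,addn0,add0n).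
by lra.
Qed.

(** The three terms come from Stirling's bound, from the primes up to [y], and from the tail beyond
    [y]. All are controlled by [1 / y] and [log y / y], which are largest at [y = 144]. *)
Lemma mertens_error_le y n : (144 <= y)%N -> (y ^ 2 <= n < y.+1 ^ 2)%N ->
  (1 + ln n%:R) / n%:R + y%:R * (3/4 * ln n%:R) / n%:R + (ln y%:R + 2) / y%:R
    <= (101 + 3/10)/1000 :> R.
Proof.
move=> y144 /andP[yn ny].
have y0 : (0 < y)%N by lia.
have y0' : 0 < y%:R :> R by rewrite ltr0n.
have n0 : (0 < n)%N by apply: leq_trans yn; rewrite expn_gt0 y0.
have n0' : 0 < n%:R :> R by rewrite ltr0n.
have L1 : ln n%:R <= 2 * ln y%:R + 2 * y%:R^-1 :> R.
  apply: (@le_trans _ _ (ln (y.+1 ^ 2)%:R)).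
    by apply: ler_ln_nat => //; exact: ltnW.
  rewrite natrX lnXn ?ltr0n// mulr2n; have := @lnS_le R y y0.
  by move: (ln y.+1%:R) (ln y%:R) (y%:R^-1) => a b c; lra.
have L0 : 0 <= ln n%:R :> R by exact: ln_nat_ge0.
have l0 : 0 <= ln y%:R :> R by exact: ln_nat_ge0.
set u : R := y%:R^-1.
have u0 : 0 < u by rewrite invr_gt0.
have uy : u * y%:R = 1 by rewrite mulVf// gt_eqF.
have u144 : u <= 1/144.
  by rewrite div1r lef_pV2 ?posrE// ler_nat.
have nu : n%:R^-1 <= u ^+ 2.
  by rewrite /u exprVn lef_pV2 ?posrE ?exprn_gt0// -natrX ler_nat.
have eu : ln y%:R * u <= (346 + 71/100)/(10*1000).
  (* The tangent of the logarithm at [144] gives [log y / y <= log 144 / 144] without studying the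
     monotonicity of the quotient. *)
  have h : ln y%:R <= ln 144 + (y%:R / 144 - 1) :> R.
    rewrite -lerBlDl -ln_div ?posrE//; apply: ln_le_subr1.
    by rewrite divr_gt0.
  have : ln y%:R * u <= (ln 144 + (y%:R / 144 - 1)) * u by rewrite ler_pM2r.
  have -> : (ln 144 + (y%:R / 144 - 1)) * u = (ln 144 - 1) * u + (u * y%:R) / 144 by ring.
  have := @ln144_le; rewrite uy; nra.
rewrite -[X in (1 + _) * X + _ * X]/(n%:R^-1) -/u.
have ynu : y%:R * n%:R^-1 <= u :> R.
  apply: (@le_trans _ _ (y%:R * u ^+ 2)); first by rewrite ler_pM2l.
  by rewrite expr2 mulrCA [y%:R * u]mulrC uy mulr1.
have v0 : 0 <= n%:R^-1 :> R by rewrite invr_ge0.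
have -> : y%:R * (3/4 * ln n%:R) * n%:R^-1 = (3/4 * ln n%:R) * (y%:R * n%:R^-1) :> R by ring.
have t1 : (1 + ln n%:R) * n%:R^-1 <= (1 + ln n%:R) * u ^+ 2.
  by rewrite ler_wpM2l// addr_ge0.
have t2 : (3/4 * ln n%:R) * (y%:R * n%:R^-1) <= (3/4 * ln n%:R) * u :> R.
  by rewrite ler_wpM2l// mulr_ge0//; lra.
have t3 : ln n%:R * u <= 2 * (ln y%:R * u) + 2 * u ^+ 2.
  have : ln n%:R * u <= (2 * ln y%:R + 2 * u) * u by rewrite ler_pM2r.
  by rewrite mulrDl expr2 !mulrA.
move: (ln n%:R) (ln y%:R) (n%:R^-1) (y%:R * n%:R^-1) L0 l0 t1 t2 t3 eu.
move=> L l v w L0 l0 t1 t2 t3 eu.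
have uu : u ^+ 2 <= 1/144 * u by rewrite expr2 ler_pM2r.
have : L * u ^+ 2 <= (L * u) * (1/144).
  by rewrite expr2 mulrA ler_wpM2l// mulr_ge0// ltW.
move: t1 t2 t3 uu; rewrite mulrDl mul1r; move: (u ^+ 2) => s; nra.
Qed.

(** The tail up to [N] is included because the comparison with [log N!] produces it; it joins the
    tail from [y] to [n] into one telescoping estimate. *)
Lemma sum_ln_pred_bound n N : (144 ^ 2 <= n)%N -> (n <= N)%N ->
  1 + \sum_(0 <= p < n.+1 | prime p) ln p%:R / p.-1%:R
    + \sum_(n.+1 <= p < N.+1 | prime p) ln p%:R / (p%:R * p.-1%:R)
  <= ln (3 * n.+1)%:R :> R.
Proof.
move=> n144 nN.
have [y yn] : exists y, (y ^ 2 <= n < y.+1 ^ 2)%N.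
  have ex : exists y, (y ^ 2 <= n)%N by exists 0%N.
  have bnd y : (y ^ 2 <= n)%N -> (y <= n)%N.
    by apply: leq_trans; case: y => // y; rewrite -mulnn leq_pmull.
  case: (ex_maxnP ex bnd) => y yn ymax; exists y; rewrite yn ltnNge.
  by apply/negP => /ymax; rewrite ltnn.
have y144 : (144 <= y)%N.
  rewrite -ltnS -(ltn_exp2r _ _ (isT : (0 < 2)%N)).
  by case/andP: yn => _; exact: leq_ltn_trans.
have y8 : (8 <= y)%N by exact: leq_trans y144.
have y0 : (0 < y)%N by exact: leq_trans y144.
have yn1 : (y <= n)%N.
  by case/andP: yn => + _; apply: leq_trans; rewrite -mulnn leq_pmull.
have n0 : (0 < n)%N by exact: leq_trans yn1.
have n0' : 0 < n%:R :> R by rewrite ltr0n.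
have h1 := @sum_ln_pred_le R y n 16 y8 yn isT.
have h2 := mertens_error_le y144 yn.
have h3 := @sum_ln_div_le R y N y0.
have h4 := @ln_fact_le R n n0.
have h5 : \sum_(y.+1 <= p < n.+1 | prime p) ln p%:R / (p%:R * p.-1%:R) +
  \sum_(n.+1 <= p < N.+1 | prime p) ln p%:R / (p%:R * p.-1%:R) <= (ln y%:R + 2) / y%:R :> R.
  rewrite -(big_cat_nat _ (n := n.+1))//=.
  apply: le_trans h3; rewrite big_add1/= big_mkcond /=; apply: ler_sum_nat => k _.
  by case: ifP => // _; rewrite divr_ge0 ?ln_nat_ge0// mulr_ge0.
have h6 := harmonic16_le.
have [l1 l2] := @ln2_bounds R.
have h7 := ln3_ge.
have h8 : ln n%:R <= ln n.+1%:R :> R by exact: ler_ln_nat.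
rewrite natrM lnM ?posrE ?ltr0n//.
have h9 : \sum_(0 <= p < n.+1 | prime p) ln p%:R / p.-1%:R <=
   ln n%:R - 1 + ((1 + ln n%:R) / n%:R + y%:R * (3/4 * ln n%:R) / n%:R)
   + \sum_(y.+1 <= p < n.+1 | prime p) ln p%:R / (p%:R * p.-1%:R)
   + 2 * ln 2 * \sum_(0 <= i < 16) (16 + i)%:R^-1 :> R.
  rewrite -(ler_pM2l n0'); apply: le_trans h1 _.
  have e1 : n%:R * ((1 + ln n%:R) / n%:R) = 1 + ln n%:R :> R.
    by rewrite mulrC divfK ?gt_eqF.
  have e2 : n%:R * (y%:R * (3/4 * ln n%:R) / n%:R) = y%:R * (3/4 * ln n%:R) :> R.
    by rewrite mulrC divfK ?gt_eqF.
  move: e1 e2 h4; move: ((1 + _) / _) (y%:R * _ / _) => T1 T2.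
  do 2!move: (bigop _ _ _).
  move: (n%:R : R) (ln _) (ln _) (ln _) => *; lra.
move: h9 h2 h5 h6 h7 h8 l1 l2.
do 4!move: (bigop _ _ _).
move: ((1 + ln n%:R) / n%:R : R) (y%:R * (3/4 * ln n%:R) / n%:R : R)
  ((ln y%:R + 2) / y%:R : R) (ln n%:R : R) (ln n.+1%:R : R) (ln 3 : R) (ln 2 : R) => *.
(* With [k = 16] the constants are [0.1013 + 2 * 0.6934 * 0.7091 < 1.085], while
   [ln 3 >= 19/12 * 0.69 > 1.092]. *)
nra.
Qed.

End PrimeReciprocals.

(** * Mertens' product *)

Section AbelSummation.
Variable R : realType.
Implicit Types (n m p k N x : nat).

Lemma ln_ln_diff_le m : (1 < m)%N ->
  ln (ln m.+1%:R) - ln (ln m%:R) <= (ln m.+1%:R - ln m%:R) / ln m%:R :> R.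
Proof.
move=> m1; have l0 := ln_nat_gt0 R m1; have l1 := @ln_nat_gt0 R m.+1 (ltnW m1).
rewrite -ln_div ?posrE// mulrBl divff ?gt_eqF//.
by apply: ln_le_subr1; rewrite divr_gt0.
Qed.

(** Partial summation with the decreasing weight [1 / ln k], the discrete form of integrating
    [1 / (t * log t)]. *)
Lemma ln_ln_le_sum (a : nat -> R) n x : (0 < n)%N -> (n.+1 < x)%N ->
  (forall m, 0 <= a m) ->
  (forall m, (x <= m.+1)%N -> ln m.+1%:R - ln x%:R <= \sum_(n.+1 <= k < m.+1) a k) ->
  forall N, (x <= N.+1)%N ->
  ln (ln N.+1%:R) - ln (ln x%:R) <= \sum_(n.+1 <= k < N.+1) a k / ln k%:R.
Proof.
move=> n0 nx a0 G N xN.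
(* The induction carries the excess of the partial sum over [ln N.+1 - ln x]. Being nonnegative, it
   only shrinks when its weight passes from [1 / ln N] to [1 / ln N.+1]. *)
suff : ln (ln N.+1%:R) - ln (ln x%:R) +
    (\sum_(n.+1 <= k < N.+1) a k - (ln N.+1%:R - ln x%:R)) / ln N%:R
    <= \sum_(n.+1 <= k < N.+1) a k / ln k%:R.
  by apply: le_trans; rewrite lerDl divr_ge0 ?ln_nat_ge0// subr_ge0 G.
have [d NE] : exists d, N = (x.-1 + d)%N by exists (N - x.-1)%N; lia.
rewrite NE {N xN NE}; elim: d => [|d].
  rewrite addn0 prednK; last by lia.
  rewrite !subrr subr0 add0r mulr_suml.
  rewrite big_nat_cond [leRHS]big_nat_cond; apply: ler_sum => k /andP[/andP[nk kx] _].
  apply: ler_wpM2l => //; rewrite lef_pV2 ?posrE ?ln_nat_gt0//; try lia.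
  by apply: ler_ln_nat; lia.
rewrite addnS; set N := (x.-1 + d)%N => IH.
have N1 : (1 < N)%N by lia.
have h1 := ln_ln_diff_le (ltnW N1 : (1 < N.+1)%N).
have GN : ln N.+1%:R - ln x%:R <= \sum_(n.+1 <= k < N.+1) a k by apply: G; lia.
rewrite big_nat_recr/=; last by lia.
rewrite [leRHS]big_nat_recr/=; last by lia.
have l0 := ln_nat_gt0 R N1; have l1 := @ln_nat_gt0 R N.+1 (ltnW N1).
have l01 : ln N%:R <= ln N.+1%:R :> R by apply: ler_ln_nat; lia.
have inv : (ln N.+1%:R)^-1 <= (ln N%:R)^-1 :> R by rewrite lef_pV2.
move: h1 IH GN; move: (bigop _ _ _) (bigop _ _ _) => g s h1 IH GN.
have : (s - (ln N.+1%:R - ln x%:R)) / ln N.+1%:R <= (s - (ln N.+1%:R - ln x%:R)) / ln N%:R.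
  by apply: ler_wpM2l => //; rewrite subr_ge0.
move: h1 IH; clear; move: (_^-1) (_^-1) (a _) (ln (ln _)) (ln (ln _)) (ln (ln _)).
by move: (ln _) (ln _) (ln _) => *; lra.
Qed.
End AbelSummation.

Section MertensProduct.
Variable R : realType.
Implicit Types (n m p k N q : nat).

Lemma mertens_factor_gt0 p : prime p -> 0 < 1 - p%:R^-1 :> R.
Proof.
by move=> /prime_gt1 p1; rewrite subr_gt0 invf_lt1 ?ltr1n// ltr0n ltnW.
Qed.

Lemma mertens_prod_gt0 q : 0 < mertens_prod R q.
Proof. by apply: prodr_gt0 => p; exact: mertens_factor_gt0. Qed.

Lemma mertens_prod_cat m n : (m <= n)%N ->
  mertens_prod R n = mertens_prod R m * \prod_(m <= p < n | prime p) (1 - p%:R^-1).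
Proof. by move=> mn; rewrite /mertens_prod -big_cat_nat. Qed.

(** Each prime contributes at most [m * ln p / (p - 1)] to [log m!]. For [p > n] this is split by
    [1 / (p - 1) = 1 / p + 1 / (p * (p - 1))]; all but the sum of [ln p / p] is absorbed by
    [sum_ln_pred_bound]. *)
Lemma sum_ln_div_ge n m : (144 ^ 2 <= n)%N -> (n <= m)%N ->
  ln m.+1%:R - ln (3 * n.+1)%:R
  <= \sum_(n.+1 <= k < m.+1) (if prime k then ln k%:R / k%:R else 0) :> R.
Proof.
move=> n144 nm.
have m0 : (0 < m)%N by apply: leq_trans nm; apply: leq_trans n144.
have m0' : 0 < m%:R :> R by rewrite ltr0n.
have hb := @sum_ln_pred_bound R n m n144 nm.
have hf := @ln_fact_ge R m.
rewrite -big_mkcond/=.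
suff : ln m.+1%:R - 1 <= \sum_(0 <= p < n.+1 | prime p) ln p%:R / p.-1%:R +
   \sum_(n.+1 <= p < m.+1 | prime p) ln p%:R / (p%:R * p.-1%:R) +
   \sum_(n.+1 <= p < m.+1 | prime p) ln p%:R / p%:R :> R.
  by move: hb; do 3!move: (bigop _ _ _); move: (ln _) (ln _) => *; lra.
rewrite -(ler_pM2l m0'); apply: le_trans hf _.
rewrite ln_fact (big_cat_nat _ (n := n.+1))//= -addrA mulrDr.
apply: lerD.
  rewrite mulr_sumr; apply: ler_sum => p pp.
  rewrite mulrCA mulrC ler_wpM2l ?ln_nat_ge0//.
  have p0 : 0 < p.-1%:R :> R by rewrite ltr0n; have := prime_gt1 pp; lia.
  by rewrite ler_pdivlMr// -natrM ler_nat mulnC logn_fact_le.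
rewrite -big_split mulr_sumr /=; apply: ler_sum => p pp.
have p0 : 0 < p.-1%:R :> R by rewrite ltr0n; have := prime_gt1 pp; lia.
have p1 : 0 < p%:R :> R by rewrite ltr0n prime_gt0.
have -> : ln p%:R / (p%:R * p.-1%:R) + ln p%:R / p%:R = ln p%:R / p.-1%:R :> R.
  have pE : p%:R = p.-1%:R + 1 :> R by rewrite natr1 prednK// prime_gt0.
  by rewrite !pE in p1 *; field; rewrite !gt_eqF.
rewrite mulrCA mulrC ler_wpM2l ?ln_nat_ge0//.
by rewrite ler_pdivlMr// -natrM ler_nat mulnC logn_fact_le.
Qed.

(** Partial summation turns the lower bound for the sum of [ln p / p] into one for the sum of
    [1 / p], and [1 / p <= - ln (1 - 1 / p)]. *)
Lemma ln_mertens_prod_lower n N : (144 ^ 2 <= n)%N -> (3 * n.+1 <= N.+1)%N ->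
  ln (ln N.+1%:R) - ln (ln (3 * n.+1)%:R)
  <= ln (mertens_prod R n.+1) - ln (mertens_prod R N.+1).
Proof.
move=> n144 nN.
have n0 : (0 < n)%N by exact: leq_trans n144.
pose a k : R := if prime k then ln k%:R / k%:R else 0.
have a0 k : 0 <= a k by rewrite /a; case: ifP => // _; rewrite divr_ge0 ?ln_nat_ge0.
apply: (@le_trans _ _ (\sum_(n.+1 <= k < N.+1) a k / ln k%:R)).
  apply: ln_ln_le_sum nN => //; first by lia.
  by move=> m nm; apply: sum_ln_div_ge => //; lia.
have nN1 : (n.+1 <= N.+1)%N by lia.
rewrite (mertens_prod_cat nN1) lnM ?posrE ?mertens_prod_gt0//; last first.
  by apply: prodr_gt0 => p; exact: mertens_factor_gt0.
rewrite opprD addNKr ln_prod; last by move=> p; exact: mertens_factor_gt0.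
rewrite -sumrN [leRHS]big_mkcond /=; apply: ler_sum_nat => k /andP[nk _].
rewrite /a; case: ifP => pk; last by rewrite mul0r.
rewrite mulrAC divff ?gt_eqF ?ln_nat_gt0 ?prime_gt1// mul1r lerNr.
by apply: le_trans (ln_le_subr1 (mertens_factor_gt0 pk)) _; rewrite addrAC subrr add0r.
Qed.

End MertensProduct.

(** * Euler products and Euler's constant *)

Section Sieve.
Variables (R : realType) (f : nat -> R) (Z : R).
Hypothesis f0 : f 0%N = 0.
Hypothesis f1 : f 1%N = 1.
Hypothesis f_ge0 : forall n, 0 <= f n.
Hypothesis fM : forall m n, f (m * n)%N = f m * f n.
Hypothesis fZ : forall X, \sum_(0 <= n < X) f n <= Z.

Let c N n := all (fun p => prime p ==> ~~ (p %| n)%N) (iota 0 N).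

Let S N X := \sum_(0 <= n < X | c N n) f n.

Let cS N n : c N.+1 n = c N n && (prime N ==> ~~ (N %| n)%N).
Proof. by rewrite /c -addn1 iotaD all_cat /= andbT. Qed.

Let S_ndecr N : nondecreasing_seq (S N).
Proof.
apply/nondecreasing_seqP => X; rewrite /S [leRHS]big_mkcond big_nat_recr//= -big_mkcond.
by rewrite lerDl; case: ifP.
Qed.

Let S_cvg N : cvgn (S N).
Proof.
apply: nondecreasing_is_cvgn (@S_ndecr N) _; exists Z => _ [X _ <-].
apply: le_trans (fZ X); rewrite /S big_mkcond; apply: ler_sum => n _.
by case: ifP.
Qed.

(** The multiples of [p] below [p * X] are the [p * m] with [m < X], and such a product has no prime
    factor below [p] exactly when [m] has none. *)
Let S_prime p X : prime p -> S p (p * X) = S p.+1 (p * X) + f p * S p X.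
Proof.
move=> pp; have p0 := prime_gt0 pp.
rewrite /S (bigID (fun n => (p %| n)%N))/= addrC; congr (_ + _).
  by apply: eq_bigl => n; rewrite cS pp.
elim: X => [|X IH]; first by rewrite muln0 !big_geq// mulr0.
rewrite mulnS addnC (big_cat_nat _ (n := (p * X)%N))//=; last exact: leq_addr.
rewrite IH [in RHS]big_mkcond big_nat_recr//= -big_mkcond mulrDr; congr (_ + _).
rewrite big_mkcond big_ltn; last by rewrite -[ltnLHS]addn0 ltn_add2l.
rewrite /= dvdn_mulr// andbT big1_seq ?addr0.
  have -> : c p (p * X) = c p X.
    apply: eq_in_all => r; rewrite mem_iota add0n => rp.
    have [pr|//] := boolP (prime r); rewrite Euclid_dvdM// dvdn_prime2//.
    by rewrite (ltn_eqF rp).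
  by case: ifP; rewrite ?fM// mulr0.
move=> n /andP[_]; rewrite mem_index_iota => /andP[n1 n2].
rewrite (_ : (p %| n)%N = false) ?andbF//; apply/negP => /dvdnP[m nE].
move: n1 n2; rewrite nE [(p * X + p)%N]addnC -mulnS [(m * p)%N]mulnC !ltn_pmul2l// ltnS => h.
by rewrite leqNgt h.
Qed.

Let S_lim N : (S N @ \oo --> \prod_(0 <= p < N | prime p) (1 - f p) * limn (S 0))%classic.
Proof.
elim: N => [|N IH]; first by rewrite big_geq// mul1r; exact: S_cvg.
rewrite big_mkcond big_nat_recr//= -big_mkcond.
case: ifPn => pN; last first.
  rewrite mulr1 (_ : S N.+1 = S N)//; apply/funext => X; rewrite /S.
  by apply: eq_bigl => n; rewrite cS (negbTE pN) andbT.
pose l := limn (S N.+1); have Sl : (S N.+1 @ \oo --> l)%classic by exact: S_cvg.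
(* [S_prime] relates the partial sums only at multiples of [N], so the limits are compared along
   this subsequence. *)
have mulN : ((fun X => (N * X)%N) @ \oo --> \oo)%classic.
  move=> A [M _ MA]; exists M => // X /= MX; apply: MA => /=.
  by apply: leq_trans MX _; rewrite leq_pmull// prime_gt0.
suff <- : l = \prod_(0 <= p < N | prime p) (1 - f p) * (1 - f N) * limn (S 0) by [].
have h1 : ((fun X => S N.+1 (N * X)%N) @ \oo --> l)%classic by exact: cvg_comp Sl.
have h2 := cvgB (cvg_comp _ _ mulN IH) (cvgM (cvg_cst (f N)) IH).
rewrite mulrAC mulrBr mulr1 [X in _ - X]mulrC.
apply: (cvg_unique _ h1) => //.
rewrite (_ : (fun X => S N.+1 (N * X)%N) =
  (fun X => S N (N * X)%N - f N * S N X)); first exact: h2.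
by apply/funext => X; rewrite S_prime// addrK.
Qed.

(* The partial sums over integers without prime factor below [N] converge to the
   Euler product times the full sum, and they contain the term [f 1 = 1]. *)
Lemma euler_prod_ge N : (forall p, prime p -> f p <= 1) ->
  1 <= \prod_(0 <= p < N | prime p) (1 - f p) * Z.
Proof.
move=> fp1.
have lZ : limn (S 0) <= Z.
  apply: limr_le; first exact: S_cvg.
  by exists 0%N => // X _; apply: le_trans (fZ X); rewrite /S /c.
apply: (@le_trans _ _ (\prod_(0 <= p < N | prime p) (1 - f p) * limn (S 0))).
  rewrite -(cvg_lim _ (@S_lim N))//; apply: limr_ge; first exact: S_cvg.
  exists 2%N => // X /= X2; rewrite /S big_mkcond (bigD1_seq 1%N)/= ?iota_uniq//.
    have -> : c N 1; last first.
      by rewrite f1 lerDl sumr_ge0// => i _; case: ifP.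
    by apply/allP => p _; apply/implyP => pp; rewrite dvdn1; case: eqP pp => // ->.
  by rewrite mem_index_iota.
rewrite ler_wpM2l// prodr_ge0// => p pp; rewrite subr_ge0; exact: fp1.
Qed.

End Sieve.

(** * The logarithm series with a remainder *)

Section LogSeries.
Variable R : realType.

(** At [t], the derivative of [- ln (1 - t)] exceeds that of the truncated series by
    [t ^ M / (1 - t)], at most its value at [x]. The mean value theorem on [[0, x]] concludes. *)
Lemma ln_series_ge (x : R) M : 0 < x -> x < 1 ->
  - ln (1 - x) <= \sum_(0 <= k < M) x ^+ k.+1 / k.+1%:R + x ^+ M / (1 - x) * x.
Proof.
move=> x0 x1.
pose c := x ^+ M / (1 - x).
pose g (t : R) := \sum_(0 <= k < M) t ^+ k.+1 / k.+1%:R + ln (1 - t) + c * t.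
pose dg (t : R) := \sum_(0 <= k < M) t ^+ k - (1 - t)^-1 + c.
have g' (t : R) : t < 1 -> is_derive t 1 g (dg t).
  move=> t1; rewrite /g /dg.
  have h1 : is_derive t 1 (fun t => ln (1 - t)) (- (1 - t)^-1).
    have ? : is_derive (1 - t) 1 (@ln R) (1 - t)^-1.
      by apply: is_derive1_ln; rewrite subr_gt0.
    apply: is_derive_eq (is_derive1_comp _ _) _.
    by rewrite add0r mul1r mulrN1.
  have h2 : is_derive t 1 (fun t : R => \sum_(0 <= k < M) t ^+ k.+1 / k.+1%:R)
      (\sum_(0 <= k < M) t ^+ k).
    elim: {c g dg} M => [|M IH].
      rewrite (_ : (fun _ => _) = cst 0); last by apply/funext => u; rewrite big_geq.
      by rewrite big_geq//; exact: is_derive_cst.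
    rewrite (_ : (fun _ => _) = (fun u : R => \sum_(0 <= k < M) u ^+ k.+1 / k.+1%:R) +
      (M.+1%:R^-1 \*: ((@id R) ^+ M.+1))); last first.
      apply/funext => u; rewrite big_nat_recr//= [RHS]/(_ + _); congr (_ + _).
      rewrite mulrC [RHS]/(_ *: _); congr (_ * _).
      by elim: M.+1 => [|m IHm]; rewrite ?expr0// !exprS IHm.
    rewrite big_nat_recr//=; apply: is_deriveD.
    apply: is_derive_eq (is_deriveZ _ _) _.
    by rewrite -[LHS]/(_ * (_ * 1)) mulr1 mulrA mulVf ?mul1r// pnatr_eq0.
  have h3 : is_derive t 1 (fun t : R => c * t) c.
    apply: is_derive_eq (is_deriveZ c _) _.
    by rewrite -[LHS]/(_ * 1) mulr1.
  exact: (is_deriveD (is_deriveD h2 h1) h3).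
have cg : {within `[0, x], continuous g}%classic.
  apply: derivable_within_continuous => t; rewrite in_itv/= => /andP[_ tx].
  by apply: ex_derive; apply: g'; exact: le_lt_trans x1.
have gd t : t \in `]0, x[%R -> is_derive t 1 g (dg t).
  by rewrite in_itv/= => /andP[_ tx]; apply: g'; exact: lt_trans x1.
have [t] := MVT x0 gd cg; rewrite in_itv/= => /andP[t0 tx].
have g0 : g 0 = 0.
  rewrite /g subr0 ln1 mulr0 !addr0 big1// => k _.
  by rewrite exprS !mul0r.
rewrite g0 !subr0 => gx.
suff : 0 <= g x by rewrite /g /c; move: (bigop _ _ _) (_ / _ * _) (ln _) => *; lra.
rewrite gx mulr_ge0 ?(ltW x0)//.
have t1 : 0 < 1 - t by rewrite subr_gt0 (lt_trans tx).
rewrite /dg big_mkord.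
have -> : \sum_(i < M) t ^+ i = (1 - t ^+ M) / (1 - t).
  by rewrite -[1 - t ^+ M]opprB subrX1 -mulNr opprB [RHS]mulrC mulKf// gt_eqF.
suff : t ^+ M / (1 - t) <= c.
  have -> : (1 - t ^+ M) / (1 - t) - (1 - t)^-1 = - (t ^+ M / (1 - t)) by ring.
  by rewrite [_ + c]addrC subr_ge0.
apply: ler_pM.
- by rewrite exprn_ge0// ltW.
- by rewrite invr_ge0 ltW.
- by rewrite lerXn2r ?nnegrE// ltW.
- by rewrite lef_pV2 ?posrE ?subr_gt0//; lra.
Qed.

End LogSeries.

(** * Zeta near [1] and the weighted sum over primes *)

Section ZetaBound.
Variables (R : realType) (s : R).
Hypothesis s0 : 0 < s.

(** This is [n ^ (- 1 - s)], with value [0] at [n = 0]. *)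
Definition zeta_term (n : nat) : R :=
  if n == 0%N then 0 else expR (- s * ln n%:R) / n%:R.

Lemma zeta_term_ge0 n : 0 <= zeta_term n.
Proof. by rewrite /zeta_term; case: ifP => // _; rewrite divr_ge0 ?expR_ge0. Qed.

Lemma zeta_term1 : zeta_term 1 = 1.
Proof. by rewrite /zeta_term /= ln1 mulr0 expR0 divr1. Qed.

Lemma zeta_termM m n : zeta_term (m * n)%N = zeta_term m * zeta_term n.
Proof.
rewrite /zeta_term muln_eq0; have [->|m0] := posnP m; first by rewrite mul0r.
have [->|n0] := posnP n; first by rewrite mulr0.
by rewrite /= natrM lnM ?posrE ?ltr0n// mulrDr expRD invfM mulrACA.
Qed.

Lemma expR_ln_gt0_lt1 n : (1 < n)%N -> 0 < expR (- s * ln n%:R) < 1.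
Proof. by move=> n1; rewrite expR_gt0 expR_lt1 mulNr oppr_lt0 mulr_gt0 ?ln_nat_gt0. Qed.

(** The integral comparison in telescoping form: for [n >= 2] the term is at most
    [((n - 1) ^ (- s) - n ^ (- s)) / s]. *)
Lemma sum_zeta_term_le X : \sum_(0 <= n < X) zeta_term n <= 1 + s^-1.
Proof.
have h m : \sum_(0 <= n < m.+2) zeta_term n <= 1 + s^-1 - expR (- s * ln m.+1%:R) / s.
  elim: m => [|m IH].
    rewrite !big_nat_recr//= big_geq// zeta_term1 /zeta_term/= ln1 mulr0 expR0; lra.
  rewrite big_nat_recr//=; apply: le_trans (lerD IH (lexx _)) _.
  rewrite /zeta_term/=.
  set a := ln m.+1%:R; set b := ln m.+2%:R.
  have ab : a + m.+2%:R^-1 <= b by exact: lnS_ge.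
  suff : expR (- s * b) / s + expR (- s * b) / m.+2%:R <= expR (- s * a) / s.
    by move: (_ / _) (_ / _) (_ / _) => x y z; lra.
  have -> : expR (- s * a) = expR (- s * b) * expR (s * (b - a)).
    by rewrite -expRD; congr expR; ring.
  have e0 : 0 < expR (- s * b) := expR_gt0 _.
  have e1 := expR_ge1Dx (s * (b - a)).
  move: e0 e1; move: (expR (- s * b)) (expR (s * (b - a))) => e f e0 e1.
  have fe d : d != 0 -> e / s + e / d = e * (1 + s / d) / s.
    by move=> d0; field; rewrite d0 gt_eqF.
  rewrite fe ?pnatr_eq0//.
  rewrite ler_pM2r ?invr_gt0// ler_pM2l//; apply: le_trans e1.
  by rewrite lerD2l ler_pM2l// lerBrDl.
apply: (@le_trans _ _ (\sum_(0 <= n < X.+2) zeta_term n)).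
  rewrite [leRHS](big_cat_nat _ (n := X))//=; last by lia.
  by rewrite lerDl sumr_ge0// => n _; exact: zeta_term_ge0.
by apply: le_trans (h X) _; rewrite gerBl divr_ge0 ?expR_ge0// ltW.
Qed.

(** Replacing [- p ^ (- s) * ln (1 - 1 / p)] by the Euler factor [- ln (1 - p ^ (- 1 - s))] costs at
    most [s * ln p / (p * (p - 1))], and the Euler product is controlled by the bound [1 + 1 / s]
    for zeta. *)
Lemma sum_prime_weighted_le N :
  \sum_(0 <= p < N | prime p) - ln (1 - p%:R^-1) * expR (- s * ln p%:R)
  <= ln (1 + s^-1) + 2 * s.
Proof.
have zp p : prime p -> 0 < zeta_term p < 1.
  move=> pp; have p1 := prime_gt1 pp; have /andP[v0 v1] := expR_ln_gt0_lt1 p1.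
  rewrite /zeta_term gtn_eqF ?prime_gt0// divr_gt0 ?ltr0n ?prime_gt0//=.
  rewrite ltr_pdivrMr ?ltr0n ?prime_gt0// mul1r; apply: lt_trans v1 _.
  by rewrite ltr1n.
apply: (@le_trans _ _ (- \sum_(0 <= p < N | prime p) ln (1 - zeta_term p)
   + s * \sum_(0 <= p < N | prime p) ln p%:R / (p%:R * p.-1%:R))).
  rewrite -sumrN mulr_sumr -big_split/=; apply: ler_sum => p pp.
  have p1 := prime_gt1 pp; have p0 := prime_gt0 pp.
  have /andP[v0 v1] := expR_ln_gt0_lt1 p1.
  have vs : 1 - expR (- s * ln p%:R) <= s * ln p%:R.
    by have := expR_ge1Dx (- s * ln p%:R); lra.
  have := zp p pp; rewrite /zeta_term gtn_eqF//.
  move: v0 v1 vs; set v := expR _ => v0 v1 vs /andP[z0 z1].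
  set u : R := p%:R^-1.
  have u0 : 0 < u by rewrite invr_gt0 ltr0n.
  have u1 : 0 < 1 - u by exact: mertens_factor_gt0.
  have z1' : 0 < 1 - v * u by rewrite subr_gt0.
  have t : ln (1 - v * u) <= ln (1 - u) + (1 - v) * (u / (1 - u)).
    rewrite -lerBlDl -ln_div ?posrE//.
    apply: le_trans (ln_le_subr1 _) _; first by rewrite divr_gt0.
    by rewrite le_eqVlt; apply/orP; left; apply/eqP; field; rewrite gt_eqF.
  have t' : ln (1 - u) <= - u by apply: le_trans (ln_le_subr1 u1) _; lra.
  have uE : ln p%:R / (p%:R * p.-1%:R) = ln p%:R * (u / (1 - u) - u).
    congr (_ * _); rewrite /u.
    have pE : p%:R = p.-1%:R + 1 :> R by rewrite natr1 prednK.
    have p1' : 0 < p.-1%:R :> R by rewrite ltr0n -subn1 subn_gt0.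
    rewrite pE; field; rewrite !gt_eqF//; lra.
  have w0 : 0 <= u / (1 - u) - u.
    have -> : u / (1 - u) - u = u * u / (1 - u) by field; rewrite gt_eqF.
    by rewrite divr_ge0 ?ltW// mulr_gt0.
  rewrite uE mulrA.
  have : (1 - v) * (u / (1 - u) - u) <= s * ln p%:R * (u / (1 - u) - u).
    by rewrite ler_wpM2r.
  have : (1 - v) * ln (1 - u) <= (1 - v) * (- u) by rewrite ler_wpM2l// subr_ge0 ltW.
  move: t; move: (ln _) (ln _) (u / _) (s * _) => *; lra.
apply: lerD; last first.
  rewrite mulrC ler_pM2r//.
  (* The constant [2] is the telescoping bound [(ln y + 2) / y] at [y = 1]. *)
  have h := @sum_ln_div_le R 1 N isT; rewrite ln1 add0r divr1 in h; apply: le_trans h.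
  case: N => [|N]; first by rewrite !big_geq.
  rewrite big_mkcond big_ltn//= add0r big_add1 /=.
  case: N => [|N].
    by rewrite !big_geq.
  rewrite big_ltn//= add0r [leRHS]big_nat_recr//=.
  apply: ler_wpDr; first by rewrite divr_ge0 ?ln_nat_ge0// mulr_ge0.
  by apply: ler_sum_nat => k _; case: ifP => // _; rewrite divr_ge0 ?ln_nat_ge0// mulr_ge0.
rewrite -ln_prod; last by move=> p pp; rewrite subr_gt0; case/andP: (zp p pp).
have P0 : 0 < \prod_(0 <= p < N | prime p) (1 - zeta_term p).
  by apply: prodr_gt0 => p pp; rewrite subr_gt0; case/andP: (zp p pp).
rewrite -lnV ?posrE// ler_ln ?posrE ?invr_gt0//; last by rewrite addr_gt0 ?invr_gt0.
rewrite invf_ple ?posrE//; last by rewrite addr_gt0 ?invr_gt0.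
rewrite -[leLHS]mul1r ler_pdivrMr; last by rewrite addr_gt0 ?invr_gt0.
apply: euler_prod_ge => //.
- exact: zeta_term1.
- exact: zeta_term_ge0.
- exact: zeta_termM.
- exact: sum_zeta_term_le.
- by move=> p pp; apply/ltW; case/andP: (zp p pp).
Qed.

End ZetaBound.

(** In Abel summation [d k] carries the nonnegative weight [x ^ k - x ^ k.+1]. The indices below [K]
    have total weight [1 - x ^ K], so their loss vanishes as [x] tends to [1]. *)
Lemma abel_power_sum_ge (R : realType) (d : nat -> R) (x C e : R) (K M : nat) :
  0 < x -> x < 1 -> d 0%N = 0 -> 0 <= C + e -> 0 <= e ->
  (forall k, - C <= d k) -> (forall k, (K <= k)%N -> e <= d k) -> (K <= M)%N ->
  e * x - (C + e) * (1 - x ^+ K) <= \sum_(0 <= k < M) (d k.+1 - d k) * x ^+ k.+1.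
Proof.
move=> x0 x1 d0 Ce e0 dC de KM.
have xk k : 0 <= x ^+ k - x ^+ k.+1.
  by rewrite exprS -[X in X - _]mul1r -mulrBl mulr_ge0 ?exprn_ge0 ?subr_ge0// ltW.
have h1 N : (d N - e) * x ^+ N + e * x - (C + e) * (1 - x ^+ N) <=
    \sum_(0 <= k < N) (d k.+1 - d k) * x ^+ k.+1.
  elim: N => [|N IH]; first by rewrite big_geq// d0 expr0; nra.
  rewrite big_nat_recr//=.
  have : 0 <= (d N + C) * (x ^+ N - x ^+ N.+1).
    by rewrite mulr_ge0// -lerBlDr sub0r.
  by move: IH; move: (x ^+ N) (x ^+ N.+1) (bigop _ _ _) => *; lra.
have h2 j : (d (K + j)%N - e) * x ^+ (K + j) + e * x - (C + e) * (1 - x ^+ K) <=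
    \sum_(0 <= k < K + j) (d k.+1 - d k) * x ^+ k.+1.
  elim: j => [|j IH]; first by rewrite addn0.
  rewrite addnS big_nat_recr//=.
  have : 0 <= (d (K + j)%N - e) * (x ^+ (K + j) - x ^+ (K + j).+1).
    by rewrite mulr_ge0// subr_ge0 de// leq_addr.
  by move: IH; move: (x ^+ (K + j)) (x ^+ (K + j).+1) (x ^+ K) (bigop _ _ _) => *; lra.
apply: le_trans (_ : _ <= (d M - e) * x ^+ M + e * x - (C + e) * (1 - x ^+ K)) _.
  by rewrite lerD2r lerDr mulr_ge0 ?exprn_ge0 ?(ltW x0)// subr_ge0 de.
by have := h2 (M - K)%N; rewrite subnKC.
Qed.

(** * Euler's constant in Mertens' theorem *)

Section MertensThird.
Variable R : realType.

Lemma mertens_prod2 : mertens_prod R 2 = 1.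
Proof. by rewrite /mertens_prod big_mkcond !big_nat_recl// big_geq//= !mulr1. Qed.

Let nk (k : nat) : nat := Num.truncn (expR k%:R : R).

(** With primes up to the integer part of [e ^ k], Mertens' theorem predicts [gamma + log k], the
    same asymptotics as the harmonic sum. *)
Let q (k : nat) : R := - ln (mertens_prod R (nk k).+1).

Let nk_le k : (nk k)%:R <= expR k%:R :> R.
Proof. by rewrite truncn_le expR_ge0. Qed.

Let nk_gt k : expR k%:R < (nk k).+1%:R :> R.
Proof. by have /andP[] := truncn_itv (expR_ge0 (k%:R : R)). Qed.

Let nk_ge1 k : (1 <= nk k)%N.
Proof. by rewrite truncn_ge_nat ?expR_ge0// -[leLHS]expR0 ler_expR. Qed.

Let nkS k : (nk k <= nk k.+1)%N.
Proof. by apply: le_truncn; rewrite ler_expR ler_nat. Qed.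

Let q0 : q 0 = 0.
Proof.
rewrite /q; suff -> : nk 0 = 1%N by rewrite mertens_prod2 ln1 oppr0.
by rewrite /nk expR0 truncn1.
Qed.

Let q_ge0 k : 0 <= q k.
Proof.
rewrite /q ln_prod; last by move=> p; exact: mertens_factor_gt0.
by rewrite oppr_ge0 sumr_le0// => p _; rewrite ln_le0// gerBl invr_ge0.
Qed.

(** A prime in block [k] has [ln p <= k + 1], so its weight [p ^ (- s)] is at least
    [expR (- s) ^ k.+1]. *)
Lemma sum_blocks_le (s : R) M : 0 < s ->
  \sum_(0 <= k < M) (q k.+1 - q k) * expR (- s) ^+ k.+1
  <= \sum_(0 <= p < (nk M).+1 | prime p) - ln (1 - p%:R^-1) * expR (- s * ln p%:R).
Proof.
move=> s0; elim: M => [|M IH].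
  rewrite big_geq// sumr_ge0// => p pp; rewrite mulr_ge0 ?expR_ge0// oppr_ge0 ln_le0//.
have le1 : ((nk M).+1 <= (nk M.+1).+1)%N by rewrite ltnS.
rewrite big_nat_recr//= [leRHS](big_cat_nat _ (n := (nk M).+1))//=.
apply: lerD => //.
have -> : q M.+1 - q M = \sum_((nk M).+1 <= p < (nk M.+1).+1 | prime p) - ln (1 - p%:R^-1).
  rewrite /q (mertens_prod_cat _ le1) lnM ?posrE ?mertens_prod_gt0//; last first.
    by apply: prodr_gt0 => p; exact: mertens_factor_gt0.
  rewrite (@ln_prod _ _ (index_iota (nk M).+1 _)); last by move=> p; exact: mertens_factor_gt0.
  by rewrite sumrN opprD opprK addrAC addNr add0r.
rewrite mulr_suml [leLHS]big_nat_cond [leRHS]big_nat_cond.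
apply: ler_sum => p /andP[/andP[_ pM] pp].
apply: ler_wpM2l.
  by rewrite oppr_ge0 ln_le0// gerBl invr_ge0.
rewrite -expRM_natl ler_expR mulrN mulNr lerN2 [leRHS]mulrC ler_pM2l//.
rewrite -[leRHS]expRK ler_ln ?posrE ?expR_gt0 ?ltr0n ?prime_gt0//.
by apply: le_trans (nk_le M.+1); rewrite ler_nat.
Qed.

(* The blocks [expR k <= p < expR k.+1] are compared with the harmonic series, both
   weighted by [expR (- s * k)]: this brings in Euler's constant directly, without
   the integral of [expR (- t) * ln t]. *)
Lemma mertens_prod_frequently (d : R) N0 : 0 < d -> exists2 N, (N0 <= N)%N &
  - ln (mertens_prod R N.+1) < euler_gamma R + d + ln (ln N.+1%:R).
Proof.
move=> d0; apply: contrapT => H.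
have {}H N : (N0 <= N)%N ->
    euler_gamma R + d + ln (ln N.+1%:R) <= - ln (mertens_prod R N.+1).
  by move=> NN; rewrite leNgt; apply/negP => h; apply: H; exists N.
have d20 : 0 < d / 2 by rewrite divr_gt0.
have [K1 hK1] := harmonic_le d20.
pose K := maxn (maxn K1 N0) 1.
have KK1 k : (K <= k)%N -> [/\ (K1 <= k)%N, (N0 <= k)%N & (0 < k)%N].
  by rewrite !geq_max => /andP[/andP[]].
have knk k : (k <= nk k)%N.
  rewrite truncn_ge_nat ?expR_ge0//; have := expR_ge1Dx (k%:R : R); lra.
pose D k := q k - series harmonic k.
have D0 : D 0%N = 0 by rewrite /D q0 /series/= big_geq// subr0.
have De k : (K <= k)%N -> d / 2 <= D k.
  move=> /KK1[k1 k2 k3].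
  have := H (nk k) (leq_trans k2 (knk k)); rewrite -/(q k).
  have := hK1 k k1.
  have : ln k%:R <= ln (ln (nk k).+1%:R) :> R.
    rewrite ler_ln ?posrE ?ltr0n//; last by rewrite ln_nat_gt0// ltnS; exact: nk_ge1.
    by rewrite -[leLHS]expRK ler_ln ?posrE ?expR_gt0 ?ltr0n// ltW.
  by rewrite /D; move: (ln _) (ln _) (q k) (series _ _) (euler_gamma R) => *; lra.
pose C : R := series harmonic K.
have C0 : 0 <= C by rewrite /C /series/= sumr_ge0// => i _; exact: harmonic_ge0.
have DC k : - C <= D k.
  have [kK|Kk] := leqP k K; last first.
    by apply: le_trans (De _ (ltnW Kk)); lra.
  rewrite /D /C; have := q_ge0 k.
  have : series harmonic k <= series harmonic K :> R.
    apply: nondecreasing_series => // n _ _; exact: harmonic_ge0.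
  by move: (q k) (series _ _) (series _ _) => *; lra.
(* The losses total at most [s * B]: [4 * s] from the zeta bound, the logarithms and the truncation,
   the rest from the indices below [K]. The choice of [s] makes this at most [d / 16], against a
   gain of [15 * d / 32]. *)
pose B : R := 4 + (C + d / 2) * K%:R.
have B0 : 0 < B by rewrite ltr_wpDr// mulr_ge0//; lra.
pose s := (d / 16) / (B + d).
have Bd : 0 < B + d by lra.
have s0 : 0 < s by rewrite divr_gt0//; lra.
have sB : s * (B + d) = d / 16 by rewrite divfK// gt_eqF.
have sB' : s * B <= d / 16 by rewrite -sB ler_pM2l//; lra.
have s16 : s <= 1/16.
  by rewrite /s ler_pdivrMr//; lra.
pose x := expR (- s).
have x0 : 0 < x := expR_gt0 _.
have x1 : x < 1 by rewrite expR_lt1 oppr_lt0.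
have xs : 1 - s <= x by rewrite /x; have := expR_ge1Dx (- s); lra.
have [M KM Mx] : exists2 M, (K <= M)%N & x ^+ M / (1 - x) * x <= s.
  have nx : `|x| < 1 by rewrite gtr0_norm.
  have e0 : 0 < s * (1 - x) by rewrite mulr_gt0// subr_gt0.
  have /cvgrPdist_lt/(_ _ e0)[M0 _ hM] := cvg_expr nx.
  exists (maxn K M0); first exact: leq_maxl.
  have /= := hM (maxn K M0) (leq_maxr _ _).
  rewrite sub0r normrN ger0_norm ?exprn_ge0 ?(ltW x0)// => h.
  rewrite mulrAC ler_pdivrMr ?subr_gt0//; apply: le_trans (ltW h).
  by rewrite -[leRHS]mulr1 ler_wpM2l ?exprn_ge0 ?ltW.
have a1 := abel_power_sum_ge x0 x1 D0 _ _ DC De KM.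
have a2 : \sum_(0 <= k < M) (D k.+1 - D k) * x ^+ k.+1 =
   \sum_(0 <= k < M) (q k.+1 - q k) * x ^+ k.+1 - \sum_(0 <= k < M) x ^+ k.+1 / k.+1%:R.
  rewrite -sumrB; apply: eq_bigr => k _; rewrite /D harmonicS.
  by move: (q _) (q _) (series _ _) (x ^+ _) (_^-1) => *; lra.
have a3 := ln_series_ge M x0 x1.
have a4 := le_trans (sum_blocks_le M s0) (sum_prime_weighted_le s0 _).
have a5 : - ln s <= - ln (1 - x).
  by rewrite lerN2 ler_ln ?posrE ?subr_gt0//; lra.
have a6 : ln (1 + s^-1) <= s - ln s.
  have -> : 1 + s^-1 = (1 + s) / s by field; rewrite gt_eqF.
  rewrite ln_div ?posrE ?addr_gt0// lerD2r; exact: (le_ln1Dx (lt_trans _ s0)).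
have a7 : 1 - x ^+ K <= s * K%:R.
  by rewrite /x -expRM_natl; have := expR_ge1Dx (K%:R * - s); lra.
have a8 : (C + d / 2) * (1 - x ^+ K) <= s * (B - 4).
  apply: le_trans (_ : _ <= (C + d / 2) * (s * K%:R)) _.
    by rewrite ler_wpM2l//; lra.
  by rewrite /B le_eqVlt; apply/orP; left; apply/eqP; ring.
have {}a1 : d / 2 * x - (C + d / 2) * (1 - x ^+ K) <=
    \sum_(0 <= k < M) (D k.+1 - D k) * x ^+ k.+1 by apply: a1; lra.
rewrite a2 in a1.
have dx : d / 2 * (15/16) <= d / 2 * x by rewrite ler_pM2l//; lra.
have a9 : s * (B - 4) = s * B - 4 * s by ring.
rewrite a9 in a8; rewrite -/x in a4.
lra.
Qed.

End MertensThird.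

(** * The product over primes below 20740 *)

(** All primes below [149], so trial division finds every composite below [149 ^ 2 = 22201]. *)
Definition small_primes : seq N :=
  [:: 2; 3; 5; 7; 11; 13; 17; 19; 23; 29; 31; 37; 41; 43; 47; 53; 59; 61; 67; 71;
      73; 79; 83; 89; 97; 101; 103; 107; 109; 113; 127; 131; 137; 139]%num.

Definition has_small_factor (n : N) : bool :=
  has (fun d => [&& N.ltb 1 d, N.ltb d n & N.eqb (N.modulo n d) 0]) small_primes.

(* [U] is an upper bound of [scale] times the product of [p / (p - 1)] over the
   primes [p < n]; numbers without small factor are treated as primes, which only
   increases the bound. *)
Fixpoint mertens_check (scale : N) (fuel : nat) (n U : N) : bool :=
  if fuel isn't fuel'.+1 then true else
  if has_small_factor n then mertens_check scale fuel' (N.succ n) U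
  else N.leb (N.mul 10 U) (N.mul (N.mul 12 (N.log2 (N.mul 3 n))) scale)
    && mertens_check scale fuel' (N.succ n)
         (N.succ (N.add U (N.div U (N.pred n)))).

Lemma mertens_checkS scale fuel n U : mertens_check scale fuel.+1 n U =
  if has_small_factor n then mertens_check scale fuel (N.succ n) U
  else N.leb (N.mul 10 U) (N.mul (N.mul 12 (N.log2 (N.mul 3 n))) scale)
    && mertens_check scale fuel (N.succ n)
         (N.succ (N.add U (N.div U (N.pred n)))).
Proof. by []. Qed.

Lemma has_small_factor_composite (n : N) : has_small_factor n -> ~~ prime (N.to_nat n).
Proof.
case/hasP => d _ /and3P[/N.ltb_spec0 d1 /N.ltb_spec0 dn /N.eqb_spec nd].
have nE : n = N.mul d (N.div n d) by have := N.div_mod' n d; rewrite nd N.add_0_r.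
apply/negP => /primeP[_ /(_ (N.to_nat d))].
rewrite nE N2Nat.inj_mul multE dvdn_mulr// => /(_ isT).
rewrite -multE -N2Nat.inj_mul -nE => /orP[] /eqP h; lia.
Qed.

Lemma leq_N_to_nat (a b : N) : N.le a b -> (N.to_nat a <= N.to_nat b)%N.
Proof. by move=> ab; apply/ssrnat.leP; lia. Qed.

Section SmallPrimes.
Variable R : realType.

Let r (x : N) : R := (N.to_nat x)%:R.

(** The invariant is that [U / scale] bounds the inverse of the product from above. It survives a
    prime [n] because the rounded-up update is at least [U * n / (n - 1)]. *)
Lemma mertens_check_sound (scale : N) fuel n U :
  (0 < N.to_nat scale)%N -> (1 < N.to_nat n)%N ->
  mertens_check scale fuel n U ->
  r scale <= r U * mertens_prod R (N.to_nat n) ->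
  forall q, prime q -> (N.to_nat n <= q < N.to_nat n + fuel)%N ->
  1 <= 12/10 * (N.to_nat (N.log2 (N.mul 3 (N.of_nat q))))%:R * mertens_prod R q.
Proof.
move=> s0; elim: fuel n U => [|fuel IH] n U n1.
  by move=> _ _ q _; rewrite addn0 => /andP[a b]; move: (leq_ltn_trans a b); rewrite ltnn.
have succE : N.to_nat (N.succ n) = (N.to_nat n).+1 by rewrite N2Nat.inj_succ.
have prodS : mertens_prod R (N.to_nat n).+1 =
  mertens_prod R (N.to_nat n) * (if prime (N.to_nat n) then 1 - (N.to_nat n)%:R^-1 else 1).
  by rewrite /mertens_prod big_mkcond big_nat_recr//= -big_mkcond.
rewrite mertens_checkS; case: ifPn => [/has_small_factor_composite np|_].
  move=> ck UP q pq /andP[nq qf].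
  apply: (IH (N.succ n) U) => //; rewrite succE.
  - exact: ltnW.
  - by rewrite prodS (negbTE np) mulr1.
  - rewrite addSnnS qf andbT ltn_neqAle nq andbT.
    by apply: contraNneq np => ->.
move=> /andP[/N.leb_spec0 le ck] UP q pq /andP[nq qf].
have [qn|nnq] := eqVneq q (N.to_nat n).
  rewrite qn N2Nat.id.
  have s0' : 0 < r scale by rewrite ltr0n.
  rewrite -(ler_pM2l s0') mulr1; apply: le_trans UP _.
  rewrite mulrA ler_pM2r ?mertens_prod_gt0//.
  have : (10 * N.to_nat U <= 12 * N.to_nat (N.log2 (N.mul 3 n)) * N.to_nat scale)%N.
    by move/leq_N_to_nat: le; rewrite !N2Nat.inj_mul => h; exact: h.
  rewrite -(ler_nat R) !natrM /r.
  move: ((N.to_nat U)%:R : R) ((N.to_nat (N.log2 (N.mul 3 n)))%:R : R).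
  by move: ((N.to_nat scale)%:R : R) => c a b; lra.
apply: (IH (N.succ n) _ _ ck) => //; rewrite ?succE.
- exact: ltnW.
- have m0 := @mertens_prod_gt0 R (N.to_nat n).
  rewrite prodS; apply: le_trans UP _; rewrite [X in _ <= _ * X]mulrC mulrA ler_pM2r//.
  set W := N.div U (N.pred n).
  have hW : (N.to_nat U <= (N.to_nat n).-1 * (N.to_nat W).+1)%N.
    have := N.mul_succ_div_gt U (N.pred n); rewrite -/W; lia.
  have -> : r (N.succ (N.add U W)) = r U + (N.to_nat W).+1%:R.
    by rewrite /r -natrD; congr _%:R; lia.
  case: ifP => _; last by rewrite mulr1 lerDl.
  have nE : (N.to_nat n)%:R = (N.to_nat n).-1%:R + 1 :> R by rewrite natr1 prednK// ltnW.
  have k0 : 0 < (N.to_nat n).-1%:R :> R by rewrite ltr0n; lia.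
  move: hW; rewrite -(ler_nat R) natrM nE /r.
  move: k0; move: ((N.to_nat n).-1%:R : R) ((N.to_nat U)%:R : R)
    ((N.to_nat W).+1%:R : R) => k u w k0 h.
  have -> : (u + w) * (1 - (k + 1)^-1) = (u + w) * k / (k + 1).
    by field; rewrite gt_eqF//; lra.
  by rewrite ler_pdivlMr; lra.
- by rewrite addSnnS qf andbT ltn_neqAle nq andbT eq_sym.
Qed.

(** The existential keeps the scale abstract afterwards, so that its unary form is never computed.
    The start [2 * scale] at [n = 3] matches the product [1 / 2]. *)
Lemma mertens_check_true : exists scale,
  N.lt 0 scale /\ mertens_check scale (N.to_nat 20740) 3 (N.mul 2 scale).
Proof. by exists 1000000000000%num; split; vm_compute. Qed.

Lemma mertens_prod_small q : prime q -> odd q -> (q <= 144 ^ 2)%N ->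
  1 <= expR (euler_gamma R) * ln (3 * q)%:R * mertens_prod R q.
Proof.
move=> pq oq qs.
have q3 : (3 <= q)%N by rewrite ltn_neqAle prime_gt1// andbT; apply: contraL oq => /eqP<-.
have q20 : (N.to_nat 3 <= q < N.to_nat 3 + N.to_nat 20740)%N.
  by rewrite q3 /=; apply: leq_ltn_trans qs _; lia.
have [scale [scale_gt0 check]] := mertens_check_true.
have scale0 : (0 < N.to_nat scale)%N by apply/ssrnat.leP; lia.
have {check} := @mertens_check_sound scale _ _ _ _ _ check _ q pq q20.
have -> : mertens_prod R (N.to_nat 3) = 2^-1.
  rewrite /mertens_prod big_mkcond !big_nat_recl//= big_geq//=; lra.
have scale2 : r scale <= r (N.mul 2 scale) / 2.
  by rewrite /r N2Nat.inj_mul multE natrM mulrAC divff ?mul1r// pnatr_eq0.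
move=> /(_ scale0 isT scale2) h; apply: le_trans h _.
rewrite ler_pM2r ?mertens_prod_gt0//.
set L := N.to_nat _.
have q0 : (0 < q)%N by exact: leq_trans q3.
have hL : (2 ^ L <= 3 * q)%N.
  have [+ _] := N.log2_spec (N.mul 3 (N.of_nat q)) ltac:(lia).
  have powE k : Nat.pow (N.to_nat 2) k = (2 ^ k)%N.
    by elim: k => // k IH; rewrite expnS -IH.
  by move/leq_N_to_nat; rewrite N2Nat.inj_pow N2Nat.inj_mul Nat2N.id powE.
have lL : L%:R * ln 2 <= ln (3 * q)%:R :> R.
  rewrite mulr_natl -lnXn// -natrX; apply: ler_ln_nat => //.
  by rewrite expn_gt0.
apply: le_trans (_ : _ <= expR (euler_gamma R) * ln 2 * L%:R) _.
  by rewrite ler_wpM2r// expR_gamma_ln2.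
by rewrite -mulrA ler_pM2l ?expR_gt0// mulrC.
Qed.

End SmallPrimes.

Lemma mertens_prod_lower (R : realType) q : prime q -> odd q ->
  1 <= expR (euler_gamma R) * ln (3 * q)%:R * mertens_prod R q.
Proof.
move=> pq oq; have [|ql] := leqP q (144 ^ 2); first exact: mertens_prod_small.
have q1 := prime_gt1 pq.
have l0 : 0 < ln (3 * q)%:R :> R by apply: ln_nat_gt0; lia.
have m0 := mertens_prod_gt0 R q.
have e0 : 0 < expR (euler_gamma R) := expR_gt0 _.
rewrite leNgt; apply/negP => h.
(* The logarithmic gap [d] persists at every [N >= 3 * q] by [ln_mertens_prod_lower], which the [N]
   found next contradicts. *)
pose d := - (euler_gamma R + ln (ln (3 * q)%:R) + ln (mertens_prod R q)).
have d0 : 0 < d.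
  rewrite oppr_gt0 -[euler_gamma R]expRK -!lnM ?posrE ?mulr_gt0//.
  by rewrite ln_lt0// h !mulr_gt0.
have [N qN hN] := mertens_prod_frequently (3 * q) d0.
have qE : q = q.-1.+1 by rewrite prednK// ltnW.
have := @ln_mertens_prod_lower R q.-1 N; rewrite -qE => /(_ _ _).
rewrite -ltnS -qE ql => /(_ isT (leqW qN)).
by move: hN; rewrite /d; lra.
Qed.

(** * Densities of sifted multiples *)

Definition primorial (q : nat) : nat := \prod_(0 <= r < q | prime r) r.

Definition sifted_multiple (a n : nat) : bool :=
  (a %| n)%N && coprime (primorial (max_pdiv a)) (n %/ a).

Section Primorial.
Local Open Scope nat_scope.
Implicit Types (p q a b m n k : nat).

Lemma primorial_gt0 q : 0 < primorial q.
Proof. by apply: prodn_cond_gt0 => p; exact: prime_gt0. Qed.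

Lemma primorialS q : primorial q.+1 = primorial q * (if prime q then q else 1).
Proof. by rewrite /primorial big_mkcond big_nat_recr//= -big_mkcond. Qed.

Lemma dvdn_primorial p q : prime p -> (p %| primorial q) = (p < q).
Proof.
move=> pp; elim: q => [|q IH].
  by rewrite /primorial big_geq// dvdn1 ltn0; case: eqP pp => // ->.
rewrite primorialS Euclid_dvdM// IH ltnS [in RHS]leq_eqVlt [in RHS]orbC; congr (_ || _).
case: ifPn => pq; first by rewrite dvdn_prime2.
rewrite dvdn1 (gtn_eqF (prime_gt1 pp)); apply/esym/negbTE.
by apply: contra pq => /eqP <-.
Qed.

Lemma coprime_primorialP q m :
  reflect (forall p, prime p -> p < q -> ~~ (p %| m)) (coprime (primorial q) m).
Proof.
apply: (iffP idP) => [co p pp pq|h].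
  by rewrite -prime_coprime//; apply: coprime_dvdl co; rewrite dvdn_primorial.
apply: contraT => nco.
have g1 : 1 < gcdn (primorial q) m.
  by rewrite ltn_neqAle eq_sym nco gcdn_gt0 primorial_gt0.
have pp := pdiv_prime g1; have := pdiv_dvd (gcdn (primorial q) m).
rewrite dvdn_gcd => /andP[d1 d2].
by have := h _ pp; rewrite -dvdn_primorial// d1 d2 => /(_ isT).
Qed.

Lemma count_coprime_mul W k : 0 < W ->
  \sum_(0 <= m < W * k) coprime W m = k * totient W.
Proof.
move=> W0; elim: k => [|k IH]; first by rewrite muln0 big_geq.
rewrite mulnS addnC (big_cat_nat _ (n := W * k))//= ?leq_addr// IH mulSn addnC.
congr (_ + _); rewrite totient_count_coprime.
rewrite -{1}[W * k]add0n big_addn addKn; apply: eq_big_nat => i _.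
by rewrite /coprime addnC mulnC gcdnMDl.
Qed.

Lemma sum_dvdn (F : nat -> nat) a X : 0 < a ->
  \sum_(0 <= n < a * X | a %| n) F (n %/ a) = \sum_(0 <= m < X) F m.
Proof.
move=> a0; elim: X => [|X IH]; first by rewrite muln0 !big_geq.
rewrite mulnS addnC (big_cat_nat _ (n := a * X))//= ?leq_addr// IH big_nat_recr//=.
congr (_ + _); rewrite big_mkcond big_ltn; last by rewrite -[ltnLHS]addn0 ltn_add2l.
rewrite /= dvdn_mulr// mulKn// big1_seq ?addn0//.
move=> n /andP[_]; rewrite mem_index_iota => /andP[n1 n2].
case: ifP => // /dvdnP[m nE]; move: n1 n2.
by rewrite nE [a * X + a]addnC -mulnS [m * a]mulnC !ltn_pmul2l// ltnS => h; rewrite leqNgt h.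
Qed.

Lemma dvdn_logn a b : 0 < a -> 0 < b ->
  (forall p, prime p -> logn p a <= logn p b) -> a %| b.
Proof.
move=> a0 b0 h; apply/(dvdn_partP _ a0) => p.
by rewrite mem_primes p_part => /and3P[pp _ _]; rewrite pfactor_dvdn// h.
Qed.

Lemma logn_sifted a n p : 0 < n -> sifted_multiple a n -> prime p ->
  p < max_pdiv a -> logn p a = logn p n.
Proof.
move=> n0 /andP[an /coprime_primorialP co] pp pa.
have a0 : 0 < a by case: a an {co pa} => //; rewrite dvd0n => /eqP nE; rewrite nE in n0.
rewrite -[in RHS](divnK an) lognM ?divn_gt0 ?(dvdn_leq n0 an)// [X in _ = X + _](_ : _ = 0)//.
apply/eqP; rewrite -leqn0 leqNgt logn_gt0 mem_primes pp /=.
by rewrite negb_and (co p pp pa) orbT.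
Qed.

Lemma logn_gt_max_pdiv a p : max_pdiv a < p -> logn p a = 0.
Proof.
move=> ap; apply/eqP; rewrite -leqn0 leqNgt logn_gt0; apply/negP => h.
by move: ap; rewrite ltnNge max_pdiv_max.
Qed.

(** Below its largest prime factor, each of [a] and [b] has the same exponents as [n]. If the
    largest primes differ, the number with the smaller one divides the other; if they agree, only
    the exponent of that prime can differ, and it decides. *)
Lemma sifted_multiple_dvdn a b n : 1 < a -> 1 < b -> 0 < n ->
  sifted_multiple a n -> sifted_multiple b n -> (a %| b) || (b %| a).
Proof.
wlog ab : a b / max_pdiv a <= max_pdiv b.
  move=> W a1 b1 n0 sa sb; have [h|/ltnW h] := leqP (max_pdiv a) (max_pdiv b).
    exact: W.
  by rewrite orbC; apply: W.
move=> a1 b1 n0 sa sb.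
have a0 := ltnW a1; have b0 := ltnW b1.
have [an _] := andP sa; have [bn _] := andP sb.
move: ab; rewrite leq_eqVlt => /orP[/eqP ab|ab].
  have eqlog p : prime p -> p != max_pdiv a -> logn p a = logn p b.
    move=> pp pne; have [pa|ap] := ltnP p (max_pdiv a).
      by rewrite (logn_sifted n0 sa)// (logn_sifted n0 sb)// -ab.
    by rewrite !logn_gt_max_pdiv// -?ab ltn_neqAle eq_sym pne.
  have /orP[h|h] := leq_total (logn (max_pdiv a) a) (logn (max_pdiv a) b).
    apply/orP; left; apply: dvdn_logn => // p pp.
    by have [->//|pne] := eqVneq p (max_pdiv a); rewrite eqlog.
  apply/orP; right; apply: dvdn_logn => // p pp.
  by have [->//|pne] := eqVneq p (max_pdiv a); rewrite eqlog.
apply/orP; left; apply: dvdn_logn => // p pp.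
have [pa|ap] := leqP p (max_pdiv a); last by rewrite logn_gt_max_pdiv.
rewrite (logn_sifted n0 sb pp (leq_ltn_trans pa ab)).
exact: dvdn_leq_log.
Qed.

Lemma max_pdiv_id p : prime p -> max_pdiv p = p.
Proof.
move=> pp; apply/eqP; rewrite eqn_leq max_pdiv_leq ?prime_gt0//=.
by apply: max_pdiv_max; rewrite mem_primes pp prime_gt0 /=.
Qed.

(** A prime below [pdiv a] divides neither [a] nor, being below [max_pdiv a], the cofactor
    [n %/ a]. *)
Lemma sifted_multiple_pdiv a n : 1 < a -> sifted_multiple a n -> sifted_multiple (pdiv a) n.
Proof.
move=> a1 /andP[an /coprime_primorialP co].
have pq := pdiv_prime a1; have q1 := prime_gt1 pq.
have qn : pdiv a %| n by apply: dvdn_trans an; exact: pdiv_dvd.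
have -> : sifted_multiple (pdiv a) n = coprime (primorial (pdiv a)) (n %/ pdiv a).
  by rewrite /sifted_multiple qn max_pdiv_id.
apply/coprime_primorialP => p pp pq'; apply/negP => pd.
have : p %| n by rewrite -(divnK qn) dvdn_mulr.
rewrite -(divnK an) Euclid_dvdM// => /orP[]; last first.
  by move=> pa; move: pq'; rewrite ltnNge pdiv_min_dvd// prime_gt1.
apply/negP; apply: co => //; apply: leq_trans pq' _.
by apply: max_pdiv_max; rewrite mem_primes pq (ltnW a1) pdiv_dvd.
Qed.

End Primorial.

(** * Densities as exact proportions over a common period *)

Section Density.
Variable R : realType.
Implicit Types (a q n k M : nat) (F : seq nat).

Lemma count_sifted_multiple a k : (0 < a)%N ->
  (\sum_(0 <= n < a * (primorial (max_pdiv a) * k)) sifted_multiple a n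
   = k * totient (primorial (max_pdiv a)))%N.
Proof.
move=> a0; rewrite -count_coprime_mul ?primorial_gt0//.
rewrite -(sum_dvdn (fun m => nat_of_bool (coprime (primorial (max_pdiv a)) m)) _ a0).
rewrite [RHS]big_mkcond; apply: eq_bigr => n _.
by rewrite /sifted_multiple; case: ifP.
Qed.

Lemma mertens_prod_totient q :
  mertens_prod R q = (totient (primorial q))%:R / (primorial q)%:R.
Proof.
elim: q => [|q IH].
  by rewrite /mertens_prod /primorial !big_geq//= divr1.
rewrite primorialS /mertens_prod big_mkcond big_nat_recr//= -big_mkcond -/(mertens_prod R q) IH.
case: ifPn => [pq|_]; last by rewrite muln1 mulr1.
rewrite totient_coprime; last first.
  by rewrite coprime_sym prime_coprime// dvdn_primorial// ltnn.
have w0 : (primorial q)%:R != 0 :> R by rewrite pnatr_eq0 -lt0n primorial_gt0.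
have q0 : q%:R != 0 :> R by rewrite pnatr_eq0 -lt0n prime_gt0.
rewrite (totient_prime pq) !(natrM R).
have -> : q.-1%:R = q%:R - 1 :> R by rewrite -subn1 natrB ?prime_gt0.
by field; rewrite w0 q0.
Qed.

Lemma density_sifted a M : (0 < a)%N -> (0 < M)%N ->
  (a * primorial (max_pdiv a) %| M)%N ->
  mertens_prod R (max_pdiv a) / a%:R =
  (\sum_(0 <= n < M) sifted_multiple a n)%:R / M%:R.
Proof.
move=> a0 M0 /dvdnP[k ME].
have MEE : M = (a * (primorial (max_pdiv a) * k))%N by rewrite ME [LHS]mulnC mulnA.
have k0 : (0 < k)%N by move: M0; rewrite ME; case: k {ME MEE}.
rewrite {1}MEE count_sifted_multiple// MEE mertens_prod_totient !natrM.
have w0 : (primorial (max_pdiv a))%:R != 0 :> R by rewrite pnatr_eq0 -lt0n primorial_gt0.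
have a0' : a%:R != 0 :> R by rewrite pnatr_eq0 -lt0n.
have k0' : k%:R != 0 :> R by rewrite pnatr_eq0 -lt0n.
by field; rewrite w0 a0' k0'.
Qed.

Lemma sum_density_le q F : prime q -> (2 < q)%N -> uniq F ->
  {in F, forall a, (1 < a)%N /\ pdiv a = q} ->
  {in F &, forall a b, a != b -> ~~ (a %| b)%N} ->
  \sum_(a <- F) mertens_prod R (max_pdiv a) / a%:R <= mertens_prod R q / q%:R.
Proof.
move=> pq q2 uF Fq Fdvd.
pose M := ((\prod_(a <- F) (a * primorial (max_pdiv a))) * (q * primorial q))%N.
have M0 : (0 < M)%N.
  rewrite !muln_gt0 primorial_gt0 (prime_gt0 pq) !andbT big_seq.
  by apply: prodn_cond_gt0 => a /Fq[/ltnW a1 _]; rewrite muln_gt0 primorial_gt0 a1.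
have M0' : 0 < M%:R :> R by rewrite ltr0n.
have qE : max_pdiv q = q by exact: max_pdiv_id.
have -> : mertens_prod R q / q%:R = (\sum_(0 <= n < M) sifted_multiple q n)%:R / M%:R.
  rewrite -{1}qE (@density_sifted q M) ?(prime_gt0 pq)//.
  by rewrite qE dvdn_mull.
have -> : \sum_(a <- F) mertens_prod R (max_pdiv a) / a%:R =
   (\sum_(a <- F) \sum_(0 <= n < M) sifted_multiple a n)%:R / M%:R.
  rewrite natr_sum mulr_suml big_seq [RHS]big_seq; apply: eq_bigr => a aF.
  have [a1 _] := Fq a aF; apply: density_sifted => //; first exact: ltnW.
  by rewrite dvdn_mulr// (big_rem a)//= dvdn_mulr.
rewrite ler_pM2r ?invr_gt0// ler_nat exchange_big/=.
apply: leq_sum => n _.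
rewrite -(big_mkcond (fun a => sifted_multiple a n) (fun=> 1%N)) sum1_count.
have [hasF|] := boolP (has (fun a => sifted_multiple a n) F); last first.
  by rewrite has_count -leqNgt leqn0 => /eqP->.
have /hasP[a aF an] := hasF; have [a1 aq] := Fq a aF.
have qn : sifted_multiple q n by rewrite -aq; exact: sifted_multiple_pdiv.
have n0 : (0 < n)%N.
  rewrite lt0n; apply: contraTneq qn => ->.
  (* As [2 < q], the prime [2] is sifted, and it divides the cofactor [0]. *)
  rewrite /sifted_multiple dvdn0 div0n qE/=; apply/negP => /coprime_primorialP.
  by move=> /(_ 2%N isT q2); rewrite dvdn0.
rewrite qn -size_filter; apply: (@uniq_leq_size _ _ [:: a]); first exact: filter_uniq.
move=> b; rewrite mem_filter inE => /andP[bn bF]; have [b1 bq] := Fq b bF.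
apply/eqP/eqP; apply: contraT => ab.
have /orP[] := sifted_multiple_dvdn a1 b1 n0 an bn => d.
  by have := Fdvd a b aF bF; rewrite eq_sym ab d => /(_ isT).
by have := Fdvd b a bF aF ab; rewrite d.
Qed.

Lemma composite_term_le a : odd a -> (1 < a)%N -> a != pdiv a ->
  (a%:R * ln a%:R)^-1 <= expR (euler_gamma R) * (mertens_prod R (max_pdiv a) / a%:R).
Proof.
move=> oa a1 ap; set P := max_pdiv a.
have pP : prime P by exact: max_pdiv_prime.
have aE := divnK (max_pdiv_dvd a); rewrite -/P in aE.
have oP : odd P by move: oa; rewrite -aE oddM => /andP[].
have om : odd (a %/ P) by move: oa; rewrite -{1}aE oddM => /andP[].
have m1 : (a %/ P)%N != 1%N.
  apply: contra ap => /eqP m1; move: aE; rewrite m1 mul1n => aE.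
  by rewrite -{2}aE pdiv_id// aE.
have m3 : (3 <= a %/ P)%N by move: om m1; case: (a %/ P)%N => [|[|[|]]].
have P3 : (3 * P <= a)%N by rewrite -{1}aE leq_mul2r m3 orbT.
have key := mertens_prod_lower R pP oP.
have la : ln (3 * P)%:R <= ln a%:R :> R.
  by apply: ler_ln_nat => //; rewrite muln_gt0 (prime_gt0 pP).
have l0 := ln_nat_gt0 R a1.
have a0 : 0 < a%:R :> R by rewrite ltr0n ltnW.
rewrite invfM mulrA mulrC ler_pM2r ?invr_gt0// -[leLHS]mul1r ler_pdivrMr//.
apply: le_trans key _; rewrite mulrAC ler_pM2l//.
by rewrite mulr_gt0 ?expR_gt0 ?mertens_prod_gt0.
Qed.

(** If [q] lies in [F], primitivity leaves [F = {q}]. Otherwise all elements are composite and the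
    density bound applies; its excess over [1 / (q * log q)] is at most [0] for a Mertens prime and
    a term of [epsilon0] for any other. *)
Lemma sum_same_pdiv_le q F : prime q -> (2 < q)%N -> uniq F ->
  {in F, forall a, [/\ odd a, (1 < a)%N & pdiv a = q]} ->
  {in F &, forall a b, a != b -> ~~ (a %| b)%N} ->
  \sum_(a <- F) (a%:R * ln a%:R)^-1 <= (q%:R * ln q%:R)^-1 +
    (if `[< mertens_prime R q >] then 0
     else expR (euler_gamma R) / q%:R * mertens_prod R q - (q%:R * ln q%:R)^-1).
Proof.
move=> pq q2 uF Fq Fdvd.
have q0 : 0 < q%:R :> R by rewrite ltr0n prime_gt0.
have lq : 0 < ln q%:R :> R by rewrite ln_nat_gt0 ?prime_gt1.
have [qF|qF] := boolP (q \in F).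
  have -> : F = [:: q].
    apply: perm_small_eq => //; apply: uniq_perm => // a; rewrite inE.
    apply/idP/eqP => [aF|->//]; apply/eqP; apply: contraT => aq.
    have [_ _ aE] := Fq a aF.
    by have := Fdvd q a qF aF; rewrite eq_sym aq -aE pdiv_dvd => /(_ isT).
  rewrite big_seq1 lerDl; case: ifPn => // /asboolP nm.
  rewrite subr_ge0 invfM [leLHS]mulrC [leRHS]mulrAC ler_pM2r ?invr_gt0//.
  by rewrite leNgt; apply/negP => /ltW h; apply: nm.
apply: (@le_trans _ _ (expR (euler_gamma R) * (mertens_prod R q / q%:R))).
  apply: (@le_trans _ _ (\sum_(a <- F)
      expR (euler_gamma R) * (mertens_prod R (max_pdiv a) / a%:R))).
    rewrite big_seq [leRHS]big_seq; apply: ler_sum => a aF; have [oa a1 aq] := Fq a aF.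
    by apply: composite_term_le => //; rewrite aq; apply: contraNneq qF => <-.
  rewrite -mulr_sumr ler_pM2l ?expR_gt0//; apply: sum_density_le => //.
  by move=> a /Fq[].
case: ifPn => [/asboolP[_ h]|_]; last by rewrite addrC subrK mulrA mulrAC.
by rewrite addr0 invfM mulrA [leRHS]mulrC ler_pM2r ?invr_gt0.
Qed.

End Density.

(** * Grouping a primitive set by least prime factor *)

Theorem theorem4p3 (R : realType) (A : set nat)
    (hA : primitive_set A) (hodd : forall a : nat, A a -> odd a) :
  (\esum_(a in A) ((a%:R * ln a%:R)^-1 : R)%:E
   <= \esum_(p in prime_divisors A) ((p%:R * ln p%:R)^-1 : R)%:E
      + epsilon0 R)%E.
Proof.
have [A1 Advd] := hA.
apply: ub_ereal_sup => _ [X [finX XA] <-].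
rewrite fsbig_finite//=; set F := finmap.enum_fset (fset_set X).
have uF : uniq F by exact: finmap.fset_uniq.
have FA a : a \in F -> A a.
  by rewrite in_fset_set// inE => /XA.
(* [S] is a finite part of [prime_divisors A], and [T] below a finite part of the index set of
   [epsilon0], so each finite sum is at most the corresponding series. *)
pose S := undup [seq pdiv a | a <- F].
pose err q : R := expR (euler_gamma R) / q%:R * mertens_prod R q - (q%:R * ln q%:R)^-1.
pose T := [seq q <- S | ~~ `[< mertens_prime R q >]].
have SP q : q \in S -> [/\ prime q, odd q & prime_divisors A q].
  rewrite mem_undup => /mapP[a aF ->]; have Aa := FA a aF.
  have pa := pdiv_prime (A1 a Aa); split => //.
    by apply: dvdn_odd (hodd a Aa); exact: pdiv_dvd.
  by split => //; exists a => //; exact: pdiv_dvd.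
have uS : uniq S by exact: undup_uniq.
have sumFS : \sum_(a <- F) (a%:R * ln a%:R)^-1 <=
    \sum_(q <- S) (q%:R * ln q%:R)^-1 + \sum_(q <- T) err q.
  have -> : \sum_(a <- F) (a%:R * ln a%:R)^-1 =
      \sum_(q <- S) \sum_(a <- [seq a <- F | pdiv a == q]) (a%:R * ln a%:R)^-1 :> R.
    under [RHS]eq_bigr do rewrite big_filter big_mkcond/=.
    rewrite [RHS]exchange_big/= big_seq [RHS]big_seq; apply: eq_bigr => a aF.
    rewrite -[RHS]big_mkcond/= -[RHS]big_filter.
    have -> : [seq q <- S | pdiv a == q] = [:: pdiv a].
      have -> : [seq q <- S | pdiv a == q] = [seq q <- S | pred1 (pdiv a) q].
        by apply: eq_filter => q; rewrite /= eq_sym.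
      by apply: filter_pred1_uniq => //; rewrite mem_undup map_f.
    by rewrite big_seq1.
  rewrite /T [X in _ <= _ + X]big_filter [X in _ <= _ + X]big_mkcond.
  rewrite -big_split/= big_seq [leRHS]big_seq.
  apply: ler_sum => q qS; have [pq oq _] := SP q qS.
  have q2 : (2 < q)%N.
    by rewrite ltn_neqAle prime_gt1// andbT; apply: contraL oq => /eqP<-.
  apply: le_trans (@sum_same_pdiv_le R q _ pq q2 _ _ _) _.
  - exact: filter_uniq.
  - move=> a; rewrite mem_filter => /andP[/eqP aq aF].
    by split => //; [exact: hodd (FA a aF)|exact: A1 (FA a aF)].
  - move=> a b; rewrite !mem_filter => /andP[_ aF] /andP[_ bF].
    exact: Advd (FA a aF) (FA b bF).
  by rewrite lerD2l; case: ifP.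
rewrite sumEFin.
apply: (@le_trans _ _ ((\sum_(q <- S) (q%:R * ln q%:R)^-1)%:E + (\sum_(q <- T) err q)%:E)%E).
  by rewrite -EFinD lee_fin.
apply: leeD.
- apply: esum_ge; exists [set` S]%classic; first by split; [exact: finite_seq|move=> q /SP[]].
  by rewrite -fsbig_seq// sumEFin.
- apply: esum_ge; exists [set` T]%classic.
    split; [exact: finite_seq|move=> q /=]; rewrite mem_filter => /andP[/asboolPn nm /SP[pq oq _]].
    by split.
  by rewrite -fsbig_seq ?filter_uniq// sumEFin.
Qed.
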